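(* Let $H$ be a complex Hilbert space. Let $A$ be an unbounded closed and symmetric operator in $H$ with domain $D(A)$, and let $B\in B(H)$ be self-adjoint. Assume that $BA$ is normal. Then $A$ is necessarily self-adjoint. If it is further assumed that $B$ is positive, then $BA$ is self-adjoint and $BA=AB$.
   Context: Operators are linear and defined on a linear subspace (the domain) of the complex Hilbert space $H$; ''unbounded'' means not assumed to be bounded or everywhere defined. $B(H)$ is the algebra of bounded, everywhere defined linear operators on $H$. $S\subset T$ means $D(S)\subset D(T)$ and $S=T$ on $D(S)$; equality of operators includes equality of domains. The product $ST$ has domain $D(ST)=\{x\in D(T): Tx\in D(S)\}$. A densely defined operator $T$ is symmetric if $T\subset T^*$, self-adjoint if $T=T^*$, and normal if it is closed and $TT^*=T^*T$. An operator $B\in B(H)$ is positive if it is self-adjoint and $\langle Bx,x\rangle\ge 0$ for all $x\in H$. *)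

(* Defs.v *)
From HB Require Import structures.
From mathcomp Require Import all_boot all_order all_algebra.
From mathcomp Require Import sesquilinear complex.
From mathcomp Require Import all_classical all_reals all_analysis.
Import Order.TTheory GRing.Theory Num.Theory.
Import numFieldNormedType.Exports.

Set Implicit Arguments.
Unset Strict Implicit.
Unset Printing Implicit Defensive.

Local Open Scope classical_set_scope.
Local Open Scope ring_scope.
Local Open Scope complex_scope.

(* A possibly unbounded operator: the values of [opfun T] outside [opdom T]
   are junk, and no definition below depends on them. *)
Record operator (H : Type) := Operator { opdom : set H; opfun :> H -> H }.

Section Operators.
Context {R : realType} {H : completeNormedModType R[i]}.
Implicit Types S T : operator H.

Definition linear_operator T :=
  [/\ opdom T 0,
      forall (a : R[i]) (x y : H),
        opdom T x -> opdom T y -> opdom T (a *: x + y) &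
      forall (a : R[i]) (x y : H),
        opdom T x -> opdom T y -> T (a *: x + y) = a *: T x + T y].

Definition bounded_operator T :=
  [/\ linear_operator T, opdom T = setT &
      exists M : R[i], forall x : H, `|T x| <= M * `|x|].

Definition suboperator S T :=
  opdom S `<=` opdom T /\ forall x, opdom S x -> S x = T x.

Definition eqoperator S T :=
  opdom S = opdom T /\ forall x, opdom S x -> S x = T x.

Definition mul_operator S T : operator H :=
  Operator [set x | opdom T x /\ opdom S (T x)] (fun x => S (T x)).

Definition densely_defined T := dense (opdom T).

Definition closed_operator T :=
  closed [set p : H * H | opdom T p.1 /\ p.2 = T p.1].

(* The first argument of a form is the linear one; [ip] is meant to be the
   inner product whose norm is the norm of [H]. *)
Variable ip : {dot H for Num.conj}.

Definition adjoint_value T (y z : H) :=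
  forall x, opdom T x -> ip (T x) y = ip x z.

(* Only meaningful when [T] is densely defined: the value [z] chosen by [xget]
   is then unique. *)
Definition adjoint T : operator H :=
  Operator [set y | exists z, adjoint_value T y z]
           (fun y => xget 0 (adjoint_value T y)).

Definition symmetric_operator T :=
  densely_defined T /\ suboperator T (adjoint T).

Definition self_adjoint T :=
  densely_defined T /\ eqoperator T (adjoint T).

Definition normal_operator T :=
  [/\ densely_defined T, closed_operator T &
      eqoperator (mul_operator T (adjoint T)) (mul_operator (adjoint T) T)].

(* In [R[i]], [0 <= z] says that [z] is real and nonnegative. *)
Definition positive_operator T :=
  self_adjoint T /\ forall x : H, 0 <= ip (T x) x.

End Operators.

(* Main.v *)
Require Import Defs.
From HB Require Import structures.
From mathcomp Require Import all_boot all_order all_algebra.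
From mathcomp Require Import sesquilinear complex.
From mathcomp Require Import all_classical all_reals all_analysis.
From mathcomp Require Import ring lra.

(* Write N = BA.  If x and N x are in D(A), then N^* (A x) = A (N x), so
   |N^k A x| = |N^*^k A x| = |A N^k x|: A preserves the space of vectors on
   which the iterates of N grow like r^k, without any appeal to the
   Fuglede-Putnam theorem.  On this space N is bounded by r, hence A, which is
   bounded with respect to N^2, is a bounded symmetric operator, and a vector y
   with A^* y = s y, s = +-i, must be orthogonal to it.  As these spaces span a
   dense subspace, the deficiency spaces vanish and A is self-adjoint.

   If moreover B >= 0, then N is symmetric for the positive semidefinite form
   <N x, A y> = <B A x, A y>.  On a subspace invariant under N where
   |N - c| <= r < |Im c|, iterating N - c forces this form, and then the
   subspace, to vanish.  Hence the spectral subspaces of N for the discs which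
   avoid the real axis are trivial, Im <N x, x> = 0, and BA = N = N^* = AB.

   The spectral subspaces are kernels of K - |K|, with K a bounded self-adjoint
   operator built from N and from R = (1 + N^* N)^-1. *)

Import Order.TTheory GRing.Theory Num.Theory.
Import numFieldNormedType.Exports.

Set Implicit Arguments.
Unset Strict Implicit.

Local Open Scope classical_set_scope.
Local Open Scope ring_scope.
Local Open Scope complex_scope.

(** * Real part of the inner product, norms and limits *)

Section InnerProduct.
Context (R : realType) (H : completeNormedModType R[i]).
Context (ip : {dot H for Num.conj}).
Hypothesis ip_norm : forall x : H, `|x| ^+ 2 = ip x x.
Implicit Types (x y z : H) (u v : nat -> H).

(** Real parts live in an ordered field, and nothing is lost: in an identity linear in x, replacing
    x by 'i x recovers the imaginary part. *)
Definition rp x y : R := complex.Re (ip x y).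
Definition nm x : R := complex.Re `|x|.

Lemma ipC x y : ip x y = (ip y x)^*%C.
Proof. by rewrite hermC expr0 mul1r. Qed.
Lemma ipDl x y z : ip (x + y) z = ip x z + ip y z. Proof. exact: linearDl. Qed.
Lemma ipDr x y z : ip x (y + z) = ip x y + ip x z. Proof. exact: linearDr. Qed.
Lemma ipNl x y : ip (- x) y = - ip x y. Proof. exact: linearNl. Qed.
Lemma ip0l y : ip 0 y = 0. Proof. exact: linear0l. Qed.
Lemma ip0r y : ip y 0 = 0. Proof. exact: linear0r. Qed.
Lemma ipZl a x y : ip (a *: x) y = a * ip x y.
Proof. exact: linearZl_LR. Qed.
Lemma ipZr a x y : ip x (a *: y) = a^*%C * ip x y.
Proof. exact: linearZr_LR. Qed.

Lemma rpC x y : rp x y = rp y x.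
Proof. by rewrite /rp ipC; case: (ip y x). Qed.
Lemma rpDl x y z : rp (x + y) z = rp x z + rp y z.
Proof. by rewrite /rp ipDl raddfD. Qed.
Lemma rpNl x y : rp (- x) y = - rp x y.
Proof. by rewrite /rp ipNl raddfN. Qed.
Lemma rpBl x y z : rp (x - y) z = rp x z - rp y z.
Proof. by rewrite rpDl rpNl. Qed.
Lemma rpZl (a : R) x y : rp (a%:C *: x) y = a * rp x y.
Proof. by rewrite /rp ipZl; case: (ip x y) => p q /=; rewrite mul0r subr0. Qed.
Lemma rpDr x y z : rp x (y + z) = rp x y + rp x z.
Proof. by rewrite rpC rpDl rpC (rpC z). Qed.
Lemma rpNr x y : rp x (- y) = - rp x y.
Proof. by rewrite rpC rpNl rpC. Qed.
Lemma rpBr x y z : rp x (y - z) = rp x y - rp x z.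
Proof. by rewrite rpDr rpNr. Qed.
Lemma rpZr (a : R) x y : rp x (a%:C *: y) = a * rp x y.
Proof. by rewrite rpC rpZl rpC. Qed.
Lemma rp0l y : rp 0 y = 0. Proof. by rewrite /rp ip0l. Qed.
Lemma rp0r y : rp y 0 = 0. Proof. by rewrite /rp ip0r. Qed.
Definition rpE := (rpDl, rpDr, rpBl, rpBr, rpNl, rpNr, rpZl, rpZr).

Lemma rpZ_adj (a : R[i]) x y : rp (a *: x) y = rp x (a^*%C *: y).
Proof. by rewrite /rp ipZl ipZr conjcK. Qed.

Lemma rp_iC x y : rp ('i%C *: x) y = - rp x ('i%C *: y).
Proof.
rewrite rpZ_adj -rpNr -scaleNr; congr (rp _ (_ *: _)).
by apply/eqP; rewrite eq_complex /= oppr0 !eqxx.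
Qed.

Lemma scale_ii x : 'i%C *: ('i%C *: x) = - x :> H.
Proof. by rewrite scalerA -expr2 sqr_i scaleN1r. Qed.

Lemma rp_ii x y : rp ('i%C *: x) ('i%C *: y) = rp x y.
Proof. by rewrite rp_iC scale_ii rpNr opprK. Qed.

Lemma rp_i x y : rp ('i%C *: x) y = - complex.Im (ip x y).
Proof. by rewrite /rp ipZl mulrC ReiNIm. Qed.

Lemma nmE x : `|x| = (nm x)%:C.
Proof. by rewrite /nm RRe_real// ger0_real. Qed.
Lemma nm_ge0 x : 0 <= nm x.
Proof. by rewrite -ler0c -nmE. Qed.
Lemma ip_nm x : ip x x = (nm x ^+ 2)%:C.
Proof. by rewrite -ip_norm nmE rmorphXn. Qed.
Lemma rp_nm x : rp x x = nm x ^+ 2.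
Proof. by rewrite /rp ip_nm. Qed.
Lemma rp_ge0 x : 0 <= rp x x.
Proof. by rewrite rp_nm sqr_ge0. Qed.
Lemma rpZZ (a : R[i]) x :
  rp (a *: x) (a *: x) = complex.Re (a * a^*%C) * rp x x.
Proof.
rewrite /rp ipZl ipZr mulrA ip_nm; case: (a * _) => p q /=.
by rewrite mulr0 subr0.
Qed.

Lemma rpD_sq x y : rp (x + y) (x + y) <= 2 * (rp x x + rp y y).
Proof. have := rp_ge0 (x - y); rewrite !rpE (rpC y x); lra. Qed.

Lemma nm0 : nm 0 = 0.
Proof. by rewrite /nm normr0. Qed.
Lemma nm0_eq x : nm x = 0 -> x = 0.
Proof. by move=> h; apply/eqP; rewrite -normr_eq0 nmE h. Qed.
Lemma rp0_eq x : rp x x = 0 -> x = 0.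
Proof. by rewrite rp_nm => /eqP; rewrite expf_eq0 => /andP[_ /eqP /nm0_eq]. Qed.
Lemma nmN x : nm (- x) = nm x.
Proof. by rewrite /nm normrN. Qed.
Lemma nmC x y : nm (x - y) = nm (y - x).
Proof. by rewrite -nmN opprB. Qed.
Lemma nmD x y : nm (x + y) <= nm x + nm y.
Proof. by rewrite -lecR rmorphD /= -!nmE ler_normD. Qed.
Lemma nmZ a x : nm (a *: x) = complex.Re `|a| * nm x.
Proof. by rewrite /nm normrZ normc_def nmE /= mul0r subr0. Qed.
Lemma nmZr (a : R) x : nm (a%:C *: x) = `|a| * nm x.
Proof. by rewrite nmZ normc_def /= expr0n addr0 sqrtr_sqr. Qed.
Lemma nm_le x y : rp x x <= rp y y -> nm x <= nm y.
Proof. by rewrite !rp_nm ler_sqr ?nnegrE ?nm_ge0. Qed.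

Lemma nm_le_sq x (c : R) : 0 <= c -> rp x x <= c ^+ 2 -> nm x <= c.
Proof.
by move=> c0; rewrite rp_nm ler_sqr // ?nnegrE ?nm_ge0.
Qed.

Lemma rp_CS x y : `|rp x y| <= nm x * nm y.
Proof.
rewrite -ler_sqr ?nnegrE ?mulr_ge0 ?nm_ge0// real_normK ?num_real// exprMn.
rewrite -!rp_nm.
have [->|y0] := eqVneq y 0; first by rewrite !rp0r expr0n mulr0.
have py : 0 < rp y y.
  rewrite lt_def rp_ge0 andbT; apply: contra_neq y0 => /rp0_eq; exact.
(* Expanding this square gives <y, y> times the gap in the inequality. *)
have := rp_ge0 ((rp y y)%:C *: x - (rp x y)%:C *: y).
rewrite !rpE (rpC y x).
rewrite [X in 0 <= X](_ : _ = rp y y * (rp x x * rp y y - rp x y ^+ 2)).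
  by rewrite pmulr_rge0// subr_ge0.
ring.
Qed.

Lemma rp_le x y : rp x y <= nm x * nm y.
Proof. exact: le_trans (ler_norm _) (rp_CS x y). Qed.

Lemma orth_eq0 x : (forall y, rp x y = 0) -> x = 0.
Proof. by move=> /(_ x) /rp0_eq. Qed.

Lemma cvg_nm u x :
  (u @ \oo --> x) <-> ((fun n => nm (u n - x)) @ \oo --> (0 : R)).
Proof.
split=> h.
  apply/cvgrPdist_lt => e e0; move/cvgrPdist_lt: h => /(_ e%:C).
  rewrite ltcR => /(_ e0); apply: filterS => n.
  by rewrite nmE ltcR sub0r normrN ger0_norm ?nm_ge0// nmC.
apply/cvgrPdist_lt => e e0.
have eE : e = (complex.Re e)%:C by rewrite RRe_real// gtr0_real.
move/cvgrPdist_lt: h => /(_ (complex.Re e)).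
rewrite -ltcR -eE => /(_ e0); apply: filterS => n.
by rewrite nmE eE ltcR sub0r normrN ger0_norm ?nm_ge0// nmC.
Qed.

Lemma cvg_squeeze0 (a b : nat -> R) :
  (forall n, 0 <= a n <= b n) -> b @ \oo --> (0 : R) -> a @ \oo --> (0 : R).
Proof.
move=> h hb; apply: (squeeze_cvgr _ (cvg_cst 0) hb); near=> n; exact: h.
Unshelve. all: by end_near. Qed.

Lemma cvg_nm_le u x (b : nat -> R) :
  (forall n, nm (u n - x) <= b n) -> b @ \oo --> (0 : R) -> u @ \oo --> x.
Proof.
move=> h hb; apply/cvg_nm; apply: cvg_squeeze0 hb => n.
by rewrite nm_ge0 h.
Qed.

Lemma cvg_unq u x y : u @ \oo --> x -> u @ \oo --> y -> x = y.
Proof. by move=> h k; apply: (cvg_unique _ h k). Qed.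

Lemma cvg_rp u v x y : u @ \oo --> x -> v @ \oo --> y ->
  (fun n => rp (u n) (v n)) @ \oo --> rp x y.
Proof.
move=> /cvg_nm hu /cvg_nm hv; apply/cvgrPdist_lt => e e0.
have hc : (fun n => nm (u n - x) * nm (v n - y) +
    (nm (u n - x) * nm y + nm x * nm (v n - y))) @ \oo --> (0 : R).
  rewrite -[X in _ --> X](_ : 0 * 0 + (0 * nm y + nm x * 0) = 0); last by ring.
  by apply: cvgD; [exact: cvgM|apply: cvgD; apply: cvgM => //; exact: cvg_cst].
move/cvgrPdist_lt: hc => /(_ e e0); apply: filterS => n.
rewrite sub0r normrN => /(le_lt_trans (ler_norm _)); apply: le_lt_trans.
rewrite distrC.
have -> : rp (u n) (v n) - rp x y = rp (u n - x) (v n - y) +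
   (rp (u n - x) y + rp x (v n - y)) by rewrite !rpE; ring.
apply: le_trans (ler_normD _ _) _; apply: lerD; first exact: rp_CS.
by apply: le_trans (ler_normD _ _) _; apply: lerD; exact: rp_CS.
Qed.

Lemma cvg_le_rp u v x y (c d : R) : u @ \oo --> x -> v @ \oo --> y ->
  (forall n, c * rp (u n) (u n) <= d * rp (v n) (v n)) ->
  c * rp x x <= d * rp y y.
Proof.
move=> hu hv h.
have h1 : (fun n => d * rp (v n) (v n) - c * rp (u n) (u n)) @ \oo -->
   d * rp y y - c * rp x x.
  by apply: cvgB; apply: cvgM; (try exact: cvg_cst); exact: cvg_rp.
rewrite -subr_ge0; apply: (@closed_cvg _ _ _ _ _ (fun z : R => 0 <= z)) h1.
  exact: closed_ge.
by near=> n; rewrite subr_ge0.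
Unshelve. all: by end_near. Qed.

(** This form of the bound is what minimizing sequences, through the parallelogram law, and monotone
    sequences of operators both produce. *)
Lemma cauchy_of_sq u (a : nat -> R) : a @ \oo --> (0 : R) ->
  (forall n m, nm (u n - u m) ^+ 2 <= a n + a m) -> exists x, u @ \oo --> x.
Proof.
move=> ha h.
suff : cvg (u @ \oo) by move=> /cvg_ex.
apply/cauchy_cvgP; apply: cauchy_exP => e e0.
have eE : e = (complex.Re e)%:C by rewrite RRe_real// gtr0_real.
set r := complex.Re e in eE; rewrite eE ltcR in e0 *.
have e2 : 0 < r ^+ 2 / 2 by rewrite divr_gt0// exprn_gt0.
move/cvgrPdist_lt: ha => /(_ _ e2) [N _ hN].
exists (u N); exists N => // n /= Nn.
rewrite -ball_normE /ball_ /= nmE ltcR -ltr_sqr ?nnegrE ?nm_ge0 ?(ltW e0)//.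
apply: le_lt_trans (h N n) _.
have := hN N (leqnn N); have := hN n Nn => /=.
rewrite !sub0r !normrN => /(le_lt_trans (ler_norm _)) h1.
move=> /(le_lt_trans (ler_norm _)) h2; lra.
Qed.

Lemma cauchy_of_le u v y (c : R) : v @ \oo --> y ->
  (forall n m, rp (u n - u m) (u n - u m) <= c * rp (v n - v m) (v n - v m)) ->
  exists x, u @ \oo --> x.
Proof.
move=> /cvg_nm hv h.
apply: (@cauchy_of_sq u (fun n => 2 * `|c| * (nm (v n - y) * nm (v n - y)))).
  rewrite -[X in _ --> X](_ : 2 * `|c| * (0 * 0) = 0); last by ring.
  by apply: cvgM; [exact: cvg_cst|exact: cvgM].
move=> n m; rewrite -rp_nm; apply: le_trans (h n m) _.
apply: le_trans (ler_wpM2r (rp_ge0 _) (ler_norm c)) _.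
rewrite -!mulrDr -!(mulrA 2) [2 * _]mulrCA ler_wpM2l//.
rewrite -!expr2 -!rp_nm.
have -> : v n - v m = (v n - y) - (v m - y) by rewrite opprB addrA subrK.
(* |p - q|^2 <= 2 (|p|^2 + |q|^2) follows from |p + q|^2 >= 0. *)
have := rp_ge0 ((v n - y) + (v m - y)).
move: (v n - y) (v m - y) => p q; rewrite !rpE (rpC q p); lra.
Qed.

(** * Linear operators and closed graphs *)

(* Convertible to linear_operator (Operator D T). *)
Definition lin_on (D : set H) (T : H -> H) :=
  [/\ D 0, forall a x y, D x -> D y -> D (a *: x + y) &
      forall a x y, D x -> D y -> T (a *: x + y) = a *: T x + T y].

Section PartialLinear.
Context (D : set H) (T : H -> H) (T_lin : lin_on D T).

Lemma dom0 : D 0. Proof. by case: T_lin. Qed.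
Lemma domZ a x : D x -> D (a *: x).
Proof. by case: T_lin => D0 h _ Dx; rewrite -[_ *: _]addr0; exact: h. Qed.
Lemma domD x y : D x -> D y -> D (x + y).
Proof. by case: T_lin => _ h _ Dx Dy; rewrite -[x]scale1r; exact: h. Qed.
Lemma domN x : D x -> D (- x).
Proof. by rewrite -scaleN1r; exact: domZ. Qed.
Lemma domB x y : D x -> D y -> D (x - y).
Proof. by move=> Dx Dy; apply: domD => //; exact: domN. Qed.
Lemma opD x y : D x -> D y -> T (x + y) = T x + T y.
Proof.
by case: T_lin => _ _ h Dx Dy; have := h 1 _ _ Dx Dy; rewrite !scale1r.
Qed.
Lemma op0 : T 0 = 0.
Proof.
have := opD dom0 dom0; rewrite addr0 => /eqP.
by rewrite eq_sym -subr_eq0 addrK => /eqP.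
Qed.
Lemma opZ a x : D x -> T (a *: x) = a *: T x.
Proof.
case: T_lin => D0 _ h Dx; have := h a _ _ Dx D0.
by rewrite !addr0 op0 addr0.
Qed.
Lemma opN x : D x -> T (- x) = - T x.
Proof. by move=> Dx; rewrite -scaleN1r opZ// scaleN1r. Qed.
Lemma opB x y : D x -> D y -> T (x - y) = T x - T y.
Proof. by move=> Dx Dy; rewrite opD ?opN//; exact: domN. Qed.
End PartialLinear.

Definition graph_closed (D : set H) (T : H -> H) := forall u x y,
  (forall n, D (u n)) -> u @ \oo --> x -> (T \o u) @ \oo --> y ->
  D x /\ T x = y.

(** At t = - b / (c + 1) the quadratic equals - b^2 (c + 2) / (c + 1)^2; the shift by 1 covers c =
    0. *)
Lemma quad_ge0_coef (b c : R) : 0 <= c ->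
  (forall t, 0 <= 2 * t * b + t ^+ 2 * c) -> b = 0.
Proof.
move=> c0 /(_ (- b / (c + 1))) h.
have c1 : 0 < c + 1 by lra.
have : 0 <= - (b ^+ 2 * (c + 2)).
  have := mulr_ge0 (ltW (exprn_gt0 2 c1)) h.
  congr (0 <= _); field; lra.
rewrite oppr_ge0 => hb; apply/eqP; rewrite -sqrf_eq0 eq_le sqr_ge0 andbT.
by move: hb; rewrite pmulr_lle0//; lra.
Qed.

(* Euler equation of a minimizer of |x - h|^2 + |T x - g|^2. *)
Lemma least_squares (D : set H) (T : H -> H) (h g : H) : lin_on D T ->
  graph_closed D T ->
  exists2 x, D x & forall z, D z -> rp (x - h) z + rp (T x - g) (T z) = 0.
Proof.
move=> Tl Tc.
pose F x := rp (x - h) (x - h) + rp (T x - g) (T x - g).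
have F0 x : 0 <= F x by rewrite addr_ge0// rp_ge0.
pose S := [set F x | x in D].
have S0 : S !=set0 by exists (F 0); exists 0 => //; exact: (dom0 Tl).
have Sb : has_lbound S by exists 0 => _ [x _ <-].
have Si : has_inf S by [].
have dF x : D x -> inf S <= F x by move=> Dx; apply: ge_inf => //; exists x.
have /choice[u hu] : forall n : nat, exists x, D x /\ F x < inf S + harmonic n.
  move=> n; have [_ [x Dx <-] hx] := inf_adherent (harmonic_gt0 n) Si.
  by exists x.
have uD n : D (u n) := (hu n).1.
pose a n : R := 2 * harmonic n.
have a0 : a @ \oo --> (0 : R).
  rewrite -[X in _ --> X](mulr0 2); apply: cvgM; first exact: cvg_cst.
  exact: cvg_harmonic.
(* Parallelogram law: the midpoint [w] also costs at least [inf S], which leaves little room for the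
   differences. *)
have par n m : rp (u n - u m) (u n - u m) +
    rp (T (u n) - T (u m)) (T (u n) - T (u m)) <= a n + a m.
  pose w := (2^-1)%:C *: (u n + u m).
  have Dnm := domD Tl (uD n) (uD m).
  have Dw : D w by apply: (domZ Tl).
  have := dF _ Dw; have := (hu n).2; have := (hu m).2.
  rewrite /F /a /w (opZ Tl)// (opD Tl)//.
  move: (T (u n)) (T (u m)) (u n) (u m) (harmonic n) (harmonic m) (inf S).
  move=> p' q' p q e f d; rewrite !rpE.
  have := (rpC q p, rpC q' p', rpC h p, rpC h q, rpC g p', rpC g q').
  by do 5! case; lra.
have [x hx] : exists x, u @ \oo --> x.
  apply: (cauchy_of_sq a0) => n m; apply: le_trans (par n m).
  by rewrite -rp_nm lerDl rp_ge0.
have [y hy] : exists y, (T \o u) @ \oo --> y.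
  apply: (cauchy_of_sq a0) => n m; apply: le_trans (par n m).
  by rewrite -rp_nm lerDr rp_ge0.
have [Dx Tx] := Tc u x y uD hx hy.
have Fx : F x <= inf S.
  have h1 : (fun n => inf S + harmonic n - F (u n)) @ \oo -->
      inf S + 0 - F x.
    rewrite /F Tx; apply: cvgB.
      by apply: cvgD; [exact: cvg_cst|exact: cvg_harmonic].
    by apply: cvgD; apply: cvg_rp; (apply: cvgB; last exact: cvg_cst).
  rewrite -subr_ge0 -[inf S]addr0.
  apply: (@closed_cvg _ _ _ _ _ (fun z : R => 0 <= z)) h1.
    exact: closed_ge.
  by near=> n; rewrite subr_ge0 ltW// (hu n).2.
(* F (x + t w) - F x is a nonnegative quadratic in t whose linear coefficient is twice the Euler
   expression. *)
exists x => // w Dw; apply: (@quad_ge0_coef _ (rp w w + rp (T w) (T w))).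
  by rewrite addr_ge0// rp_ge0.
move=> t; have Dtw := domZ Tl t%:C Dw.
have := le_trans Fx (dF _ (domD Tl Dx Dtw)).
rewrite /F (opD Tl)// (opZ Tl)// -subr_ge0; congr (0 <= _).
rewrite !rpE (rpC w x) (rpC w h) (rpC (T w)) (rpC (T w) g).
rewrite (rpC h x) (rpC g (T x)); ring.
Unshelve. all: by end_near. Qed.

(* Gliding hump: the increments 3^-n of x are oriented so as to increase
   |<x, w n>|, and the later ones cannot undo more than half of this. *)
Lemma weakly_bounded_bounded (F : set H) :
  (forall x, exists c : R, forall w, F w -> `|rp x w| <= c) ->
  exists c : R, forall w, F w -> nm w <= c.
Proof.
move=> Fb; apply/not_notP => Fu.
have /choice[w hw] : forall n : nat, exists w, F w /\ n%:R * 3 ^+ n < nm w.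
  move=> n; apply/not_notP => hn; apply: Fu; exists (n%:R * 3 ^+ n) => w Fw.
  by rewrite leNgt; apply/negP => hlt; apply: hn; exists w.
have w0 n : 0 < nm (w n).
  by apply: le_lt_trans (hw n).2; rewrite mulr_ge0// exprn_ge0.
pose s n x : R := if 0 <= rp x (w n) then 1 else -1.
have [x xS] : exists x : nat -> H, forall k,
    x k.+1 = x k + (s k (x k) * 3^-1 ^+ k / nm (w k))%:C *: w k.
  pose fix x n : H := if n is k.+1 then
    x k + (s k (x k) * 3^-1 ^+ k / nm (w k))%:C *: w k else 0.
  by exists x.
have s1 n y : `|s n y| = 1 by rewrite /s; case: ifP; rewrite ?normrN normr1.
have p3 n : 0 < (3^-1 : R) ^+ n by rewrite exprn_gt0.
have step n : nm (x n.+1 - x n) <= 3^-1 ^+ n.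
  rewrite xS addrC addKr nmZr !normrM s1 mul1r gtr0_norm//.
  by rewrite gtr0_norm ?invr_gt0// divfK// gt_eqF.
(* The right side is exactly the sum of 3^-j over n <= j < n + k. *)
have tail n k : nm (x (n + k)%N - x n) <= 3 / 2 * (3^-1 ^+ n - 3^-1 ^+ (n + k)).
  elim: k => [|k IH]; first by rewrite addn0 subrr nm0 subrr mulr0.
  rewrite addnS -(subrK (x (n + k)%N) (x _)) -addrA.
  apply: le_trans (nmD _ _) _; have := step (n + k)%N.
  by rewrite exprS; lra.
have tail' n m : (n <= m)%N -> nm (x m - x n) <= 3 / 2 * 3^-1 ^+ n.
  move=> /subnKC <-; apply: le_trans (tail _ _) _.
  have := p3 (n + (m - n))%N; lra.
have [l xl] : exists l : H, x @ \oo --> l.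
  pose a n : R := (3 / 2 * 3^-1 ^+ n) * (3 / 2 * 3^-1 ^+ n).
  have a0 : a @ \oo --> (0 : R).
    have h0 : (fun n : nat => 3 / 2 * 3^-1 ^+ n : R) @ \oo --> (0 : R).
      rewrite -[X in _ --> X](mulr0 (3 / 2)).
      apply: cvgM; first exact: cvg_cst.
      by apply: cvg_expr; rewrite ger0_norm; lra.
    by rewrite -[X in _ --> X](mulr0 0); exact: cvgM.
  apply: (cauchy_of_sq a0) => n m.
  suff key i j : (i <= j)%N -> nm (x j - x i) ^+ 2 <= a i + a j.
    case/orP: (leq_total n m) => ij; first by rewrite nmC; exact: key.
    by rewrite (addrC (a n)); exact: key.
  move=> /tail' ij; rewrite /a -!expr2.
  rewrite (le_trans (_ : _ <= (3 / 2 * 3^-1 ^+ i) ^+ 2))//.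
    by rewrite lerXn2r ?nnegrE ?nm_ge0// mulr_ge0// ltW.
  by rewrite lerDl sqr_ge0.
(* The increments from step n + 1 on sum to at most 3/2 * 3^-(n+1), half of 3^-n, so half of the
   gain 3^-n |w n| >= n survives in the limit. *)
have big n : n%:R / 2 <= `|rp l (w n)|.
  have h1 : (fun k => `|rp (x k) (w n)|) @ \oo --> `|rp l (w n)|.
    by apply: cvg_norm; apply: cvg_rp => //; exact: cvg_cst.
  apply: (@closed_cvg _ _ _ _ _ (fun z : R => n%:R / 2 <= z)) h1.
    exact: closed_ge.
  near=> k; have nk : (n.+1 <= k)%N by near: k; exact: nbhs_infty_ge.
  have h2 : 3^-1 ^+ n * nm (w n) <= `|rp (x n.+1) (w n)|.
    rewrite xS !rpE rp_nm.
    have -> : s n (x n) * 3^-1 ^+ n / nm (w n) * nm (w n) ^+ 2 =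
        s n (x n) * (3^-1 ^+ n * nm (w n)).
      by rewrite -!mulrA expr2 mulKf// gt_eqF.
    have e0 := mulr_ge0 (ltW (p3 n)) (ltW (w0 n)).
    rewrite /s; case: ifPn => [q0|]; first by rewrite ger0_norm; lra.
    by rewrite -ltNge => q0; rewrite ltr0_norm; lra.
  have h3 : `|rp (x k - x n.+1) (w n)| <= 3 / 2 * 3^-1 ^+ n.+1 * nm (w n).
    apply: le_trans (rp_CS _ _) _; rewrite ler_wpM2r ?nm_ge0//; exact: tail'.
  have h4 : n%:R <= 3^-1 ^+ n * nm (w n).
    have := ltW (hw n).2; rewrite -(ler_pM2l (p3 n)); congr (_ <= _).
    by rewrite mulrCA -exprMn mulVf// expr1n mulr1.
  have : `|rp (x n.+1) (w n)| <= `|rp (x k) (w n)| + `|rp (x k - x n.+1) (w n)|.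
    rewrite -[X in `|X|](_ : rp (x k) (w n) - rp (x k - x n.+1) (w n) = _).
      by apply: le_trans (ler_normB _ _) _.
    by rewrite rpBl; ring.
  rewrite exprS in h3; lra.
have [c hc] := Fb l.
have [n hn] : exists n : nat, `|2 * c| < n%:R.
  by exists (Num.bound `|2 * c|); rewrite archi_boundP.
have := le_trans (big n) (hc _ (hw n).1).
have := ler_norm (2 * c); lra.
Unshelve. all: by end_near. Qed.

(** * Bounded operators *)

Definition lin (f : H -> H) := forall a x y, f (a *: x + y) = a *: f x + f y.
Definition bdd (f : H -> H) :=
  exists2 c : R, 0 <= c & forall x, nm (f x) <= c * nm x.
Definition blin (f : H -> H) := lin f /\ bdd f.
(** For complex-linear f this real identity amounts to symmetry for [ip], on replacing x by 'i x. *)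
Definition herm (f : H -> H) := forall x y, rp (f x) y = rp x (f y).
Definition commutes (f g : H -> H) := forall x, f (g x) = g (f x).

Lemma lin_lin_on f : lin f -> lin_on setT f.
Proof. by move=> fl; split=> // a x y _ _. Qed.

Section Linear.
Context (f : H -> H) (f_lin : lin f).
Lemma linB x y : f (x - y) = f x - f y.
Proof. by rewrite (opB (lin_lin_on f_lin)). Qed.
Lemma linD x y : f (x + y) = f x + f y.
Proof. by rewrite (opD (lin_lin_on f_lin)). Qed.
Lemma linZ a x : f (a *: x) = a *: f x.
Proof. by rewrite (opZ (lin_lin_on f_lin)). Qed.
Lemma lin0 : f 0 = 0.
Proof. by rewrite (op0 (lin_lin_on f_lin)). Qed.
End Linear.

Lemma cvg_le_nm u v x y (c : R) : u @ \oo --> x -> v @ \oo --> y -> 0 <= c ->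
  (forall n, nm (u n) <= c * nm (v n)) -> nm x <= c * nm y.
Proof.
move=> hu hv c0 h.
rewrite -ler_sqr ?nnegrE ?mulr_ge0 ?nm_ge0// exprMn -!rp_nm -[rp x x]mul1r.
apply: (cvg_le_rp hu hv) => n; rewrite mul1r !rp_nm -exprMn.
by rewrite ler_sqr ?nnegrE ?mulr_ge0 ?nm_ge0.
Qed.

Lemma blin_cvg f u x : blin f -> u @ \oo --> x -> (f \o u) @ \oo --> f x.
Proof.
move=> [fl [c c0 fb]] /cvg_nm hu.
apply: (@cvg_nm_le _ _ (fun n => c * nm (u n - x))) => [n|].
  by rewrite /= -(linB fl) fb.
by rewrite -[X in _ --> X](mulr0 c); apply: cvgM => //; exact: cvg_cst.
Qed.

Lemma blin_id : blin id.
Proof. by split=> //; exists 1 => // x; rewrite mul1r. Qed.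
Lemma blin_comp f g : blin f -> blin g -> blin (f \o g).
Proof.
move=> [fl [c c0 fb]] [gl [d d0 gb]]; split=> [a x y /=|].
  by rewrite gl fl.
exists (c * d); first exact: mulr_ge0.
by move=> x /=; apply: le_trans (fb _) _; rewrite -mulrA ler_wpM2l.
Qed.
Lemma blin_add f g : blin f -> blin g -> blin (fun x => f x + g x).
Proof.
move=> [fl [c c0 fb]] [gl [d d0 gb]]; split=> [a x y /=|].
  by rewrite fl gl scalerDr addrACA.
exists (c + d); first exact: addr_ge0.
by move=> x; apply: le_trans (nmD _ _) _; rewrite mulrDl lerD.
Qed.
Lemma blin_scale (a : R[i]) f : blin f -> blin (fun x => a *: f x).
Proof.
move=> [fl [c c0 fb]]; split=> [b x y /=|].
  by rewrite fl scalerDr !scalerA mulrC.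
have a0 : 0 <= complex.Re `|a| by rewrite normc_def /= sqrtr_ge0.
exists (complex.Re `|a| * c) => [|x]; first exact: mulr_ge0.
by rewrite nmZ -mulrA ler_wpM2l.
Qed.
Lemma blin_sub f g : blin f -> blin g -> blin (fun x => f x - g x).
Proof.
move=> bf bg; under eq_fun do rewrite -scaleN1r.
by apply: blin_add => //; exact: blin_scale.
Qed.

(** * Monotone limits and absolute values of symmetric operators *)

Lemma contraction_sq (P : H -> H) : lin P -> herm P ->
  (forall x, 0 <= rp (P x) x <= rp x x) ->
  forall x, rp (P x) (P x) <= rp (P x) x.
Proof.
move=> Pl Ph hP x.
(* P - P^2 = (1 - P) P (1 - P) + P (1 - P) P, and both terms are positive. *)
have /andP[h1 _] := hP (x - P x); have /andP[_ h2] := hP (P x).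
move: h1; rewrite (linB Pl) !rpE (Ph (P x) x).
lra.
Qed.

(** For i <= j the operator P = Y j - Y i lies between 0 and 1, so |P x|^2 <= <P x, x>, a difference
    of two terms of a convergent real sequence. *)
Lemma strong_cvg_monotone (Y : nat -> H -> H) :
  (forall n, lin (Y n)) -> (forall n, herm (Y n)) ->
  (forall n x, rp (Y n x) x <= rp (Y n.+1 x) x) ->
  (forall n x, 0 <= rp (Y n x) x <= rp x x) ->
  forall x, exists l : H, (fun n => Y n x) @ \oo --> l.
Proof.
move=> Yl Yh Ymon Yb x.
pose q n := rp (Y n x) x.
have qmon z : {homo (fun n => rp (Y n z) z) : n m / (n <= m)%N >-> n <= m}.
  by apply: homo_leq => [t|a b c|n]; [exact: lexx|exact: le_trans|exact: Ymon].
have qub : has_ubound (range q).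
  by exists (rp x x) => _ [n _ <-]; case/andP: (Yb n x).
have qs := nondecreasing_cvgn (qmon x) qub.
set s := sup (range q) in qs.
have qle n : q n <= s by apply: ub_le_sup => //; exists n.
pose a n := s - q n.
have a0 : a @ \oo --> (0 : R).
  rewrite -[X in _ --> X](subrr s); apply: cvgB => //; exact: cvg_cst.
apply: (cauchy_of_sq a0) => n m.
have key i j : (i <= j)%N -> nm (Y j x - Y i x) ^+ 2 <= a i + a j.
  move=> ij; pose P z := Y j z - Y i z.
  have := @contraction_sq P; rewrite /P -rp_nm => /(_ _ _ _ x) h.
  apply: (le_trans (h _ _ _)).
  - move=> c y z; rewrite Yl Yl scalerBr opprD addrACA //.
  - by move=> y z; rewrite !rpE Yh Yh.
  - move=> z; rewrite rpBl subr_ge0 qmon//=.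
    by have /andP[_] := Yb j z; have /andP[+ _] := Yb i z; lra.
  rewrite rpBl /a -/(q i) -/(q j); have := qle i; have := qle j; lra.
case/orP: (leq_total n m) => ij; first by rewrite nmC; exact: key.
by rewrite (addrC (a n)); exact: key.
Qed.

(* Polynomials in W with nonnegative coefficients: they are positive when W is,
   and their products are visibly of the same kind. *)
Inductive pos_poly (W : H -> H) : (H -> H) -> Prop :=
| pos_poly0 f : (forall x, f x = 0) -> pos_poly W f
| pos_polyS (a : R) g f : 0 <= a -> pos_poly W g ->
    (forall x, f x = a%:C *: x + W (g x)) -> pos_poly W f.

Section PosPoly.
Context (W : H -> H) (W_lin : lin W).

Lemma pos_poly_add f g h : pos_poly W f -> pos_poly W g ->
  (forall x, h x = f x + g x) -> pos_poly W h.
Proof.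
move=> pf; elim: pf g h => {f} [f f0|a f' f a0 pf' IH fE] g h pg hE.
  have -> // : h = g by apply/funext => x; rewrite hE f0 add0r.
case: pg hE => {g} [g g0|b g' g b0 pg' gE] hE.
  apply: (pos_polyS a0 pf') => x; by rewrite hE g0 addr0 fE.
apply: (pos_polyS (addr_ge0 a0 b0) (IH g' _ pg' (fun=> erefl))) => x.
by rewrite hE fE gE (linD W_lin) rmorphD /= scalerDl addrACA.
Qed.

Lemma pos_poly_scale (b : R) f h : 0 <= b -> pos_poly W f ->
  (forall x, h x = b%:C *: f x) -> pos_poly W h.
Proof.
move=> b0 pf; elim: pf h => {f} [f f0|a f' f a0 pf' IH fE] h hE.
  by apply: pos_poly0 => x; rewrite hE f0 scaler0.
apply: (pos_polyS (mulr_ge0 b0 a0) (IH _ (fun=> erefl))) => x.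
by rewrite hE fE (linZ W_lin) scalerDr scalerA -rmorphM.
Qed.

Lemma pos_poly_id : pos_poly W id.
Proof.
apply: (pos_polyS ler01 (pos_poly0 _ (fun=> erefl))) => x.
by rewrite (lin0 W_lin) addr0 scale1r.
Qed.

Lemma pos_poly_mulW f : pos_poly W f -> pos_poly W (fun x => W (f x)).
Proof. by move=> pf; apply: (pos_polyS (lexx 0) pf) => x; rewrite scale0r add0r. Qed.

Lemma pos_poly_comp f g : pos_poly W f -> pos_poly W g -> pos_poly W (f \o g).
Proof.
move=> pf pg; elim: pf => {f} [f f0|a f' f a0 pf' IH fE].
  by apply: pos_poly0 => x /=; rewrite f0.
apply: (pos_poly_add (f := fun x => a%:C *: g x) _ (pos_poly_mulW IH)).
  exact: (pos_poly_scale a0 pg).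
by move=> x /=; rewrite fE.
Qed.

Lemma pos_poly_ge0 f : herm W -> (forall x, 0 <= rp (W x) x) ->
  pos_poly W f -> forall x, 0 <= rp (f x) x.
Proof.
move=> Wh W0 pf x.
(* Induction by steps of two, one W going to each argument: even powers end at |x|^2 and odd ones at
   <W x, x>. *)
have W00 k : 0 <= rp x (iter k W x).
  have [m] := ubnP k; elim: m k x => [|m IH] [|[|k]] x //= km.
  - exact: rp_ge0.
  - by rewrite rpC.
  by rewrite -Wh -iterS iterSr IH// ltnW.
(* Peeling a factor W off f moves it to the right argument, hence the power there. *)
suff: forall k, 0 <= rp (f x) (iter k W x) by move=> /(_ 0%N).
elim: pf => {f} [f f0|a f' f a0 pf' IH fE] k; first by rewrite f0 rp0l.
by rewrite fE rpDl rpZl Wh addr_ge0// ?mulr_ge0//; exact: (IH k.+1).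
Qed.
End PosPoly.

Lemma cvgR_unq (a : nat -> R) (r s : R) :
  a @ \oo --> r -> a @ \oo --> s -> r = s.
Proof. by move=> h k; apply: (cvg_unique _ h k). Qed.

Lemma cvg_blin_apply (Y : nat -> H -> H) u x y :
  (forall n, lin (Y n)) -> (forall n x, nm (Y n x) <= nm x) ->
  u @ \oo --> x -> (fun n => Y n x) @ \oo --> y ->
  (fun n => Y n (u n)) @ \oo --> y.
Proof.
move=> Yl Yc /cvg_nm hu /cvg_nm hy.
apply: (@cvg_nm_le _ _ (fun n => nm (u n - x) + nm (Y n x - y))) => [n|].
  have -> : Y n (u n) - y = Y n (u n - x) + (Y n x - y).
    by rewrite (linB (Yl n)) addrA subrK.
  by apply: le_trans (nmD _ _) _; rewrite lerD2r.
by rewrite -[X in _ --> X](addr0 0); exact: cvgD.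
Qed.

(* J is the limit of 1 - Y n, where Y n increases to the solution of
   2 Y = W + Y^2 with W = 1 - K^2. *)
Lemma operator_abs (K : H -> H) : blin K -> herm K ->
  (forall x, rp (K x) (K x) <= rp x x) ->
  exists J, [/\ blin J, herm J, forall x, 0 <= rp (J x) x,
    forall x, J (J x) = K (K x) &
    forall Z, blin Z -> commutes Z K -> commutes Z J].
Proof.
move=> Kb Kh Kc.
pose W x := x - K (K x).
have Wb : blin W by apply: blin_sub; [exact: blin_id|exact: blin_comp].
have Wl := Wb.1.
have Wh : herm W by move=> x y; rewrite /W !rpE !Kh.
have W01 x : 0 <= rp (W x) x <= rp x x.
  rewrite /W !rpE Kh; have := Kc x; have := rp_ge0 (K x); lra.
have WE x : W x = x - K (K x) by [].
clearbody W.
have W0 x : 0 <= rp (W x) x by case/andP: (W01 x).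
have Wc x : nm (W x) <= nm x.
  apply: nm_le_sq; first exact: nm_ge0.
  rewrite -rp_nm; apply: le_trans (contraction_sq Wl Wh W01 x) _.
  by case/andP: (W01 x).
have [Y [Y0 YS]] : exists Y : nat -> H -> H, (forall x, Y 0%N x = 0) /\
    forall n x, Y n.+1 x = (2^-1)%:C *: (W x + Y n (Y n x)).
  pose fix Y n : H -> H := if n is k.+1 then
    fun x => (2^-1)%:C *: (W x + Y k (Y k x)) else fun=> 0.
  by exists Y.
have Yl n : lin (Y n).
  elim: n => [|n IH] a x y; first by rewrite !Y0 scaler0 addr0.
  by rewrite !YS Wl !IH addrACA !scalerDr !scalerA (mulrC a).
have Yc n x : nm (Y n x) <= nm x.
  elim: n x => [|n IH] x; first by rewrite Y0 nm0 nm_ge0.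
  rewrite YS nmZr ger0_norm; last by lra.
  have := nmD (W x) (Y n (Y n x)); have := Wc x.
  have := IH (Y n x); have := IH x; lra.
have Yh n : herm (Y n).
  by elim: n => [|n IH] x y; rewrite ?Y0 ?rp0l ?rp0r// !YS !rpE Wh !IH.
have Ycomm Z : blin Z -> commutes Z K -> forall n, commutes Z (Y n).
  move=> [Zl _] ZK; elim=> [|n IH] x; first by rewrite !Y0 (lin0 Zl).
  by rewrite !YS (linZ Zl) (linD Zl) !IH !WE (linB Zl) !ZK.
have half : 0 <= 2^-1 :> R by lra.
have Yp n : pos_poly W (Y n).
  elim: n => [|n IH]; first exact: pos_poly0.
  apply: (pos_poly_scale Wl half _ (YS n)).
  apply: (pos_poly_add Wl (pos_poly_mulW (pos_poly_id Wl))); last by [].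
  exact: pos_poly_comp.
(* With D n = Y (n+1) - Y n, the recursion gives 2 D (n+1) = D n Y (n+1) + Y n D n. *)
have Dp n : pos_poly W (fun x => Y n.+1 x - Y n x).
  elim: n => [|n IH].
    apply: (pos_poly_scale Wl half (pos_poly_mulW (pos_poly_id Wl))) => x.
    by rewrite YS !Y0 subr0 addr0.
  apply: (pos_poly_scale Wl half (f := fun x => (Y n.+1 (Y n.+1 x) -
      Y n (Y n.+1 x)) + Y n (Y n.+1 x - Y n x))) => [|x].
    apply: (pos_poly_add Wl (pos_poly_comp Wl IH (Yp n.+1))
      (pos_poly_comp Wl (Yp n) IH)) => x //=.
  rewrite (linB (Yl n)) addrA subrK [in LHS](YS n.+1) [in X in _ - X = _](YS n).
  by rewrite -scalerBr opprD addrACA subrr add0r.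
have Ymon n x : rp (Y n x) x <= rp (Y n.+1 x) x.
  by rewrite -subr_ge0 -rpBl; exact: (pos_poly_ge0 Wh W0 (Dp n)).
have Y01 n x : 0 <= rp (Y n x) x <= rp x x.
  rewrite (pos_poly_ge0 Wh W0 (Yp n))/=; apply: le_trans (rp_le _ _) _.
  by rewrite rp_nm expr2 ler_wpM2r ?nm_ge0.
have /choice[V hV] := strong_cvg_monotone Yl Yh Ymon Y01.
have Vl : lin V.
  move=> a x y; apply: (cvg_unq (hV _)).
  under eq_fun do rewrite Yl.
  apply: cvgD => //; exact: (blin_cvg (blin_scale a blin_id) (hV x)).
have Vb : blin V.
  split=> //; exists 1 => // x.
  apply: (cvg_le_nm (hV x) (cvg_cst x)) => // n.
  by rewrite mul1r.
have VE x : (2^-1)%:C *: (W x + V (V x)) = V x.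
  have h1 : (fun n => Y n.+1 x) @ \oo --> V x.
    by have := hV x; rewrite -(cvg_shiftS (fun n => Y n x)).
  apply: (cvg_unq _ h1); under eq_fun do rewrite YS.
  apply: (blin_cvg (blin_scale _ blin_id)).
  apply: cvgD; first exact: cvg_cst.
  exact: cvg_blin_apply.
exists (fun x => x - V x); split.
- exact: blin_sub blin_id Vb.
- move=> x y; rewrite !rpE; congr (_ - _).
  have h1 : (fun n => rp (Y n x) y) @ \oo --> rp (V x) y.
    by apply: cvg_rp => //; exact: cvg_cst.
  have h2 : (fun n => rp (Y n x) y) @ \oo --> rp x (V y).
    under eq_fun do rewrite Yh.
    by apply: cvg_rp => //; exact: cvg_cst.
  exact: (cvgR_unq h1 h2).
- move=> x; rewrite rpBl subr_ge0.
  apply: (@closed_cvg _ _ _ _ _ (fun z : R => z <= rp x x) _ _ _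
    (cvg_rp (hV x) (cvg_cst x))); first exact: closed_le.
  by near=> n; case/andP: (Y01 n x).
(* As 2 V = W + V^2, (1 - V)^2 = 1 - W = K^2. *)
- move=> x; rewrite (linB Vl) -[V (V x)](addKr (W x)).
  have -> : W x + V (V x) = 2%:C *: V x.
    by rewrite -[in RHS]VE scalerA -rmorphM mulfV// scale1r.
  rewrite (_ : 2%:C *: V x = V x + V x); last first.
    by rewrite rmorphD /= scalerDl scale1r.
  rewrite WE; move: (V x) (K (K x)) => p q.
  rewrite !opprB (_ : q - x + (p + p) - p = q - (x - p)); last first.
    by rewrite addrA addrK opprB addrA addrAC.
  by rewrite addrC subrK.
- move=> Z Zb ZK x; rewrite (linB Zb.1); congr (_ - _).
  have h1 := blin_cvg Zb (hV x).
  apply: (cvg_unq h1).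
  rewrite (_ : _ \o _ = (fun n => Y n (Z x))); first exact: hV.
  by apply/funext => n /=; exact: Ycomm.
Unshelve. all: by end_near. Qed.

(** * Splitting by the sign of a bounded symmetric operator *)

Definition closed_sub (E : set H) :=
  [/\ E 0, forall a x y, E x -> E y -> E (a *: x + y) &
      forall u x, (forall n, E (u n)) -> u @ \oo --> x -> E x].

(** E is the kernel of L - J, where L is a contraction proportional to K and J = |L|. As L and J
    commute and have equal squares, the range of L + J lies in E; so y orthogonal to E satisfies L y
    = - J y, whence <L y, y> <= 0. *)
Lemma operator_split (K : H -> H) : blin K -> herm K ->
  exists E : set H, [/\ closed_sub E,
    forall Z, blin Z -> commutes Z K -> forall x, E x -> E (Z x),
    forall x, E x -> 0 <= rp (K x) x &
    forall y, (forall x, E x -> rp y x = 0) -> rp (K y) y <= 0].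
Proof.
move=> Kb Kh; have [Kl [c c0 Kc]] := Kb.
pose t := (c + 1)^-1; have t0 : 0 < t by rewrite invr_gt0; lra.
pose L x := t%:C *: K x.
have Lb : blin L by exact: blin_scale.
have Lh : herm L by move=> x y; rewrite /L !rpE Kh.
have Lc x : rp (L x) (L x) <= rp x x.
  rewrite !rp_nm ler_sqr ?nnegrE ?nm_ge0// nmZr gtr0_norm//.
  rewrite mulrC ler_pdivrMr; last by lra.
  have := Kc x; have := nm_ge0 x; lra.
have [J [Jb Jh J0 JJ JZ]] := operator_abs Lb Lh Lc.
have Ll := Lb.1; have Jl := Jb.1.
have LJ : commutes L J by exact: JZ.
have Lpos x : (0 <= rp (L x) x) = (0 <= rp (K x) x).
  by rewrite rpZl pmulr_rge0.
exists [set x | L x = J x]; split => /=.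
- split => /=; first by rewrite (lin0 Ll) (lin0 Jl).
    by move=> a x y; rewrite Ll Jl => -> ->.
  move=> u x hu ux; apply: (cvg_unq (blin_cvg Lb ux)).
  rewrite (_ : L \o u = J \o u); first exact: blin_cvg.
  exact/funext.
- move=> Z Zb ZK x e.
  have ZL : commutes Z L by move=> y; rewrite /L (linZ Zb.1) ZK.
  by rewrite -ZL e JZ.
- by move=> x e; rewrite -Lpos e.
move=> y hy.
have LJy z : L (L z + J z) = J (L z + J z).
  by rewrite (linD Ll) (linD Jl) LJ JJ addrC.
have : L y + J y = 0.
  apply: rp0_eq; rewrite {1}rpDl Lh Jh -rpDr; apply: hy; exact: LJy.
move=> /eqP; rewrite addr_eq0 => /eqP e.
have Ly : rp (L y) y <= 0 by rewrite e rpNl oppr_le0.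
by move: Ly; rewrite rpZl pmulr_rle0.
Qed.
(** * Normal operators *)

(** Divide by q^k and let k grow. Comparisons of growth rates of iterates all end here. *)
Lemma geometric_le0 (a C r q : R) : 0 <= r -> r < q ->
  (forall k, a * q ^+ k <= C * r ^+ k) -> a <= 0.
Proof.
move=> r0 rq h; have q0 : 0 < q by lra.
have h1 : (fun k => C * (r / q) ^+ k - a) @ \oo --> 0 - a.
  apply: cvgB; last exact: cvg_cst.
  apply: (@cvg_geometric _ C (r / q)).
  have rq0 : 0 <= r / q by rewrite divr_ge0// ltW.
  by rewrite ger0_norm// ltr_pdivrMr// mul1r.
rewrite -oppr_ge0 -sub0r.
apply: (@closed_cvg _ _ _ _ _ (fun z : R => 0 <= z)) h1; first exact: closed_ge.
by near=> k; rewrite subr_ge0 expr_div_n mulrA ler_pdivlMr ?exprn_gt0.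
Unshelve. all: by end_near. Qed.

(** The ratios a (k+1) / a k do not decrease; if the first one, q, exceeded r, then a k >= a 0 * q^k
    would outgrow C r^k. *)
Lemma logconvex_growth (a : nat -> R) (C r : R) : 0 <= r ->
  (forall k, 0 <= a k) -> (a 0%N = 0 -> a 1%N = 0) ->
  (forall k, a k.+1 ^+ 2 <= a k * a k.+2) ->
  (forall k, a k <= C * r ^+ k) -> a 1%N <= r * a 0%N.
Proof.
move=> r0 apos a01 conv ub; rewrite leNgt; apply/negP => hlt.
have a1 : 0 < a 1%N by apply: le_lt_trans hlt; rewrite mulr_ge0.
have a0 : 0 < a 0%N.
  rewrite lt_def apos andbT; apply/eqP => /a01 e; move: a1; rewrite e; lra.
have step k : 0 < a k /\ a 1%N * a k <= a k.+1 * a 0%N.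
  elim: k => [|k [ak hk]]; first by rewrite mulrC.
  have ak1 : 0 < a k.+1.
    have := mulr_gt0 a1 ak => h; have := lt_le_trans h hk.
    by rewrite pmulr_lgt0.
  split=> //; rewrite -(ler_pM2l ak).
  have e1 := ler_wpM2r (ltW a0) (conv k).
  have e2 := ler_wpM2l (ltW ak1) hk.
  move: e1 e2; move: (a k) (a k.+1) (a k.+2) (a 0%N) (a 1%N) => t u v w z *; lra.
pose q := a 1%N / a 0%N.
have rq : r < q by rewrite ltr_pdivlMr.
have low k : a 0%N * q ^+ k <= a k.
  elim: k => [|k IH]; first by rewrite expr0 mulr1.
  rewrite exprSr mulrA; apply: le_trans (ler_wpM2r _ IH) _; first by lra.
  by rewrite mulrA ler_pdivrMr// mulrC; case: (step k).
have := geometric_le0 r0 rq (fun k => le_trans (low k) (ub k)).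
by rewrite leNgt a0.
Qed.
(* N is a closed normal operator with domain Dn, and M, with domain Dm, is its
   adjoint. *)
Section NormalPair.
Context (Dn Dm : set H) (N M : H -> H).
Hypothesis N_lin : lin_on Dn N.
Hypothesis N_clo : graph_closed Dn N.
Hypothesis M_lin : lin_on Dm M.
Hypothesis M_val : forall x y, Dn x -> Dm y -> rp (N x) y = rp x (M y).
Hypothesis M_max : forall y z, (forall x, Dn x -> rp (N x) y = rp x z) ->
  Dm y /\ M y = z.
Hypothesis NM_dom : forall x, (Dm x /\ Dn (M x)) <-> (Dn x /\ Dm (N x)).
Hypothesis NM_comm : forall x, Dn x -> Dm (N x) -> N (M x) = M (N x).

Lemma M_clo : graph_closed Dm M.
Proof.
move=> u x y uD ux uy; apply: M_max => z Dz.
have h1 : (fun n => rp (N z) (u n)) @ \oo --> rp (N z) x.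
  by apply: cvg_rp => //; exact: cvg_cst.
have h2 : (fun n => rp (N z) (u n)) @ \oo --> rp z y.
  under eq_fun do rewrite M_val//.
  by apply: cvg_rp => //; exact: cvg_cst.
exact: cvgR_unq h1 h2.
Qed.

(** Von Neumann's argument: minimizing |x - y|^2 + |N x|^2 yields <x - y, z> + <N x, N z> = 0 for
    all z in the domain, which says that N x is in the domain of M and M (N x) = y - x. *)
Lemma resolvent_exists : exists Rv : H -> H, forall y,
  [/\ Dn (Rv y), Dm (N (Rv y)) & Rv y + M (N (Rv y)) = y].
Proof.
suff h y : exists x, [/\ Dn x, Dm (N x) & x + M (N x) = y].
  by have /choice[Rv hR] := h; exists Rv.
have [x Dx hx] := least_squares y 0 N_lin N_clo.
have [|DNx MNx] := M_max (y := N x) (z := y - x).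
  move=> z Dz; have := hx z Dz; rewrite subr0 rpBl rpBr.
  have := (rpC x z, rpC y z, rpC (N x) (N z)); do 2! case; lra.
by exists x; split => //; rewrite MNx addrC subrK.
Qed.

Variable Rv : H -> H.
Hypothesis RvP : forall y,
  [/\ Dn (Rv y), Dm (N (Rv y)) & Rv y + M (N (Rv y)) = y].

Lemma Rv_dom y : Dn (Rv y). Proof. by case: (RvP y). Qed.
Lemma Rv_domN y : Dm (N (Rv y)). Proof. by case: (RvP y). Qed.
Lemma MNRvE y : M (N (Rv y)) = y - Rv y.
Proof. by case: (RvP y) => _ _ {2}<-; rewrite addrC addKr. Qed.
Lemma Rv_domM y : Dm (Rv y).
Proof. by have [] := (NM_dom (Rv y)).2 (conj (Rv_dom y) (Rv_domN y)). Qed.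
Lemma Rv_domMN y : Dn (M (Rv y)).
Proof. by have [] := (NM_dom (Rv y)).2 (conj (Rv_dom y) (Rv_domN y)). Qed.
Lemma NMRvE y : N (M (Rv y)) = y - Rv y.
Proof. by rewrite -MNRvE NM_comm//; [exact: Rv_dom|exact: Rv_domN]. Qed.

(** Injectivity of 1 + M N: pairing d + M (N d) = 0 with d gives |d|^2 + |N d|^2 = 0. *)
Lemma Rv_eq x y : Dn x -> Dm (N x) -> x + M (N x) = y -> Rv y = x.
Proof.
move=> Dx DNx xy; have [Dr DNr ry] := RvP y.
pose d := Rv y - x.
have Dd : Dn d by exact: (domB N_lin).
have NdE : N d = N (Rv y) - N x by rewrite (opB N_lin).
have DNd : Dm (N d) by rewrite NdE; exact: (domB M_lin).
have e : d + M (N d) = 0.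
  by rewrite NdE (opB M_lin)// /d addrACA -opprD ry xy subrr.
have d0 : d = 0.
  apply: rp0_eq; apply/eqP; rewrite eq_le rp_ge0 andbT.
  have := rp_ge0 (N d); rewrite (M_val Dd DNd).
  have : rp d (d + M (N d)) = 0 by rewrite e rp0r.
  rewrite rpDr; lra.
by apply/eqP; rewrite -subr_eq0; apply/eqP.
Qed.

Lemma Rv_lin : lin Rv.
Proof.
move=> a x y; apply: Rv_eq.
- by case: N_lin => _ h _; apply: h; exact: Rv_dom.
- case: N_lin => _ _ ->; try exact: Rv_dom.
  by case: M_lin => _ h _; apply: h; exact: Rv_domN.
- case: N_lin => _ _ ->; try exact: Rv_dom.
  case: M_lin => _ _ ->; try exact: Rv_domN.
  rewrite !MNRvE addrACA -scalerDr; congr (_ *: _ + _).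
    by rewrite addrC subrK.
  by rewrite addrC subrK.
Qed.

Lemma Rv_form x y : rp (Rv x) y = rp (Rv x) (Rv y) + rp (N (Rv x)) (N (Rv y)).
Proof.
by rewrite (M_val (Rv_dom x) (Rv_domN y)) MNRvE -rpDr addrC subrK.
Qed.

Lemma Rv_herm : herm Rv.
Proof.
by move=> x y; rewrite [RHS]rpC [LHS]Rv_form [RHS]Rv_form (rpC (Rv y)) (rpC (N (Rv y))).
Qed.

Lemma Rv_ge0 x : 0 <= rp (Rv x) x.
Proof. by rewrite Rv_form addr_ge0 ?rp_ge0. Qed.

Lemma Rv_NRv_le x : rp (Rv x) (Rv x) + rp (N (Rv x)) (N (Rv x)) <= rp x x.
Proof.
have := Rv_form x x; have := rp_ge0 (x - Rv x); rewrite !rpE (rpC x (Rv x)).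
have := rp_ge0 (N (Rv x)); lra.
Qed.

Lemma Rv_le x : rp (Rv x) x <= rp x x.
Proof. by rewrite Rv_form Rv_NRv_le. Qed.

Lemma Rv_blin : blin Rv.
Proof.
split; first exact: Rv_lin.
exists 1 => // x; rewrite mul1r; apply: nm_le.
by have := Rv_NRv_le x; have := rp_ge0 (N (Rv x)); lra.
Qed.

Lemma NRv_blin : blin (N \o Rv).
Proof.
split=> [a x y /=|].
  by rewrite Rv_lin; case: N_lin => _ _ ->//; exact: Rv_dom.
exists 1 => // x /=; rewrite mul1r; apply: nm_le.
by have := Rv_NRv_le x; have := rp_ge0 (Rv x); lra.
Qed.

Lemma MRv_norm x : rp (M (Rv x)) (M (Rv x)) = rp (N (Rv x)) (N (Rv x)).
Proof.
rewrite -(M_val (Rv_domMN x) (Rv_domM x)) (M_val (Rv_dom x) (Rv_domN x)).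
by rewrite NMRvE MNRvE rpC.
Qed.

Lemma MRv_blin : blin (M \o Rv).
Proof.
split=> [a x y /=|].
  by rewrite Rv_lin; case: M_lin => _ _ ->//; exact: Rv_domM.
exists 1 => // x /=; rewrite mul1r; apply: nm_le; rewrite MRv_norm.
by have := Rv_NRv_le x; have := rp_ge0 (Rv x); lra.
Qed.

(** With u = R x, the vector M (N u) = x - u lies in the domain of N, so N u solves (1 + M N) w = N
    x; uniqueness concludes. *)
Lemma Rv_N x : Dn x -> Rv (N x) = N (Rv x).
Proof.
move=> Dx; set u := Rv x.
have Du : Dn u := Rv_dom x.
have DMw : Dn (M (N u)) by rewrite MNRvE; exact: (domB N_lin).
have [Dw DNw] := (NM_dom (N u)).1 (conj (Rv_domN x) DMw).
apply: Rv_eq => //.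
by rewrite -NM_comm// MNRvE (opB N_lin)// addrC subrK.
Qed.

Lemma Rv_M x : Dm x -> Rv (M x) = M (Rv x).
Proof.
move=> Dx; set u := Rv x.
have Du : Dm u := Rv_domM x.
apply: Rv_eq => //; first exact: Rv_domMN.
  by rewrite NMRvE; exact: (domB M_lin).
by rewrite NMRvE (opB M_lin)// addrC subrK.
Qed.

Lemma Rv_inj0 x : Rv x = 0 -> x = 0.
Proof.
move=> h; have := MNRvE x.
by rewrite h (op0 N_lin) (op0 M_lin) subr0.
Qed.

(** The powers Q^n tend strongly to 0, so the operators 1 - Q^n approximate the identity; their
    ranges lie in that of R, and they commute with N and M. *)
Let Q x := x - Rv x.

Lemma Q_lin : lin Q.
Proof. exact: (blin_sub blin_id Rv_blin).1. Qed.

Lemma iterQ_lin n : lin (iter n Q).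
Proof. by elim: n => [//|n IH] a x y; rewrite !iterS IH Q_lin. Qed.

Lemma Q_herm : herm Q.
Proof. by move=> x y; rewrite /Q !rpE Rv_herm. Qed.

Lemma iterQ_herm n : herm (iter n Q).
Proof. by elim: n => [//|n IH] x y; rewrite iterS Q_herm IH -iterSr. Qed.

Lemma Rv_Q x : Rv (Q x) = Q (Rv x).
Proof. by rewrite /Q (linB Rv_lin). Qed.

Lemma iterQ_ge0 n x : 0 <= rp (iter n Q x) x.
Proof.
have [m] := ubnP n; elim: m n x => [|m IH] [|[|n]] x //= nm'.
- exact: rp_ge0.
- by rewrite /Q rpBl subr_ge0; exact: Rv_le.
- by rewrite Q_herm -iterS iterSr IH// ltnW.
Qed.

(** The difference is <R Q^n x, x>; Q is symmetric and commutes with R, so two factors Q at a time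
    are shared between the arguments, down to n = 0 or 1. *)
Lemma iterQ_decr n x : rp (iter n.+1 Q x) x <= rp (iter n Q x) x.
Proof.
rewrite iterS {1}/Q rpBl gerBl.
have [m] := ubnP n; elim: m n x => [|m IH] [|[|n]] x //= nm'.
- exact: Rv_ge0.
- rewrite /Q (linB Rv_lin) rpBl (Rv_herm (Rv x)) subr_ge0.
  by have := Rv_form x x; have := rp_ge0 (N (Rv x)); lra.
- by rewrite Rv_Q Q_herm -iterS iterSr IH// ltnW.
Qed.

(** The decreasing powers have a strong limit; Q fixes it, so R annihilates it and it is 0. *)
Lemma iterQ_cvg0 x : (fun n => iter n Q x) @ \oo --> (0 : H).
Proof.
have Qle n z : rp (iter n Q z) z <= rp z z.
  by elim: n => [//|n IH]; exact: le_trans (iterQ_decr n z) IH.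
have [] := @strong_cvg_monotone (fun n z => z - iter n Q z) _ _ _ _ x.
- by move=> n a y z; rewrite (iterQ_lin n) scalerBr opprD addrACA.
- by move=> n y z; rewrite !rpE iterQ_herm.
- by move=> n z; rewrite !(rpBl z) lerD2l lerN2 iterQ_decr.
- move=> n z; rewrite (rpBl z) subr_ge0 Qle/= gerBl; exact: iterQ_ge0.
move=> l hl.
have hQ : (fun n => iter n Q x) @ \oo --> x - l.
  rewrite (_ : (fun n => _) = fun n => x - (x - iter n Q x)).
    by apply: cvgB => //; exact: cvg_cst.
  by apply/funext => n; rewrite opprB addrC subrK.
have hQ1 : (fun n => iter n.+1 Q x) @ \oo --> x - l.
  by have := hQ; rewrite -(cvg_shiftS (fun n => iter n Q x)).
have hQ2 : (fun n => iter n.+1 Q x) @ \oo --> Q (x - l).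
  exact: (blin_cvg (blin_sub blin_id Rv_blin) hQ).
have := cvg_unq hQ1 hQ2.
by rewrite /Q -{1}[x - l]subr0 => /addrI /oppr_inj /esym /Rv_inj0 <-.
Qed.

(** 1 - Q^n = R (1 + Q + ... + Q^(n-1)), and the sum preserves any subspace invariant under R. *)
Lemma sub_iterQ (E : set H) n x : E 0 ->
  (forall a y z, E y -> E z -> E (a *: y + z)) ->
  (forall y, E y -> E (Rv y)) -> E x ->
  exists2 w, E w & x - iter n Q x = Rv w.
Proof.
move=> E0 EL ER Ex.
have EQ k : E (iter k Q x).
  elim: k => [//|k IH]; rewrite iterS /Q.
  by rewrite addrC -scaleN1r; apply: EL => //; exact: ER.
elim: n => [|n [w Ew wE]]; first by exists 0; rewrite ?subrr ?(lin0 Rv_lin).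
exists (w + iter n Q x); first by rewrite -[w]scale1r; exact: EL.
by rewrite (linD Rv_lin) -wE iterS /Q opprB addrA addrAC.
Qed.

Lemma iterQ_N n x : Dn x -> Dn (iter n Q x) /\ N (iter n Q x) = iter n Q (N x).
Proof.
move=> Dx; elim: n => [//|n [Dq Nq]]; rewrite !iterS /Q.
have DR := Rv_dom (iter n Q x).
by split; [exact: (domB N_lin)|rewrite (opB N_lin)// Nq -Rv_N// Nq].
Qed.

Lemma iterQ_M n x : Dm x -> Dm (iter n Q x) /\ M (iter n Q x) = iter n Q (M x).
Proof.
move=> Dx; elim: n => [//|n [Dq Mq]]; rewrite !iterS /Q.
have DR := Rv_domM (iter n Q x).
by split; [exact: (domB M_lin)|rewrite (opB M_lin)// Mq -Rv_M// Mq].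
Qed.

Lemma approx_cvg x : (fun n => x - iter n Q x) @ \oo --> x.
Proof.
rewrite -[X in _ --> X]subr0.
by apply: cvgB; [exact: cvg_cst|exact: iterQ_cvg0].
Qed.

Lemma approx_Rv n x : exists w, x - iter n Q x = Rv w.
Proof. by have [] := @sub_iterQ setT n x; [..|move=> w _ e; exists w]. Qed.

(** N and M have equal norms on the range of R, where the approximations [u n] of x lie. As M (u n)
    converges, N (u n) is Cauchy, and closedness of N applies. *)
Lemma dom_adjoint x : Dm x -> Dn x /\ rp (N x) (N x) = rp (M x) (M x).
Proof.
move=> Dx; pose u n := x - iter n Q x.
have uD n : Dn (u n) by have [w] := approx_Rv n x; rewrite /u => ->; exact: Rv_dom.
have ux : u @ \oo --> x by exact: approx_cvg.
have uM : (M \o u) @ \oo --> M x.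
  rewrite (_ : M \o u = fun n => M x - iter n Q (M x)); first exact: approx_cvg.
  apply/funext => n /=; have [Dq <-] := iterQ_M n Dx; exact: (opB M_lin).
have uNM n m : rp (N (u n) - N (u m)) (N (u n) - N (u m)) =
    rp (M (u n) - M (u m)) (M (u n) - M (u m)).
  rewrite -(opB N_lin)//; have [w wE] := approx_Rv n x.
  have [w' wE'] := approx_Rv m x.
  rewrite /u wE wE' -(opB M_lin); try exact: Rv_domM.
  by rewrite -(linB Rv_lin) MRv_norm.
have [y uN] : exists y : H, (N \o u) @ \oo --> y.
  by apply: (cauchy_of_le uM (c := 1)) => n m /=; rewrite mul1r uNM.
have [Dx' Nx] := N_clo uD ux uN; split=> //.
have uNM0 n : rp (N (u n)) (N (u n)) = rp (M (u n)) (M (u n)).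
  have [w wE] := approx_Rv n x.
  by rewrite /u wE MRv_norm.
apply: le_anti; rewrite Nx -[rp y y]mul1r -[rp (M x) _]mul1r.
by apply/andP; split; [apply: (cvg_le_rp uN uM)|apply: (cvg_le_rp uM uN)]
  => n; rewrite /= uNM0.
Qed.

Lemma dom_of_dom_adjoint x : Dn x -> Dm x /\ rp (M x) (M x) = rp (N x) (N x).
Proof.
move=> Dx; pose u n := x - iter n Q x.
have uD n : Dm (u n) by have [w] := approx_Rv n x; rewrite /u => ->; exact: Rv_domM.
have ux : u @ \oo --> x by exact: approx_cvg.
have uN : (N \o u) @ \oo --> N x.
  rewrite (_ : N \o u = fun n => N x - iter n Q (N x)); first exact: approx_cvg.
  apply/funext => n /=; have [Dq <-] := iterQ_N n Dx; exact: (opB N_lin).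
have [y uM] : exists y : H, (M \o u) @ \oo --> y.
  apply: (cauchy_of_le uN (c := 1)) => n m /=; rewrite mul1r.
  have [w wE] := approx_Rv n x; have [w' wE'] := approx_Rv m x.
  rewrite /u wE wE' -(opB M_lin) -?(opB N_lin) -?(linB Rv_lin);
    try exact: Rv_domM; try exact: Rv_dom.
  by rewrite MRv_norm.
have [Dx' Mx] := M_clo uD ux uM; split=> //.
by have [] := dom_adjoint Dx'.
Qed.

(* E is where R (r^2 - (N - c)^* (N - c)) R >= 0, R being the resolvent. *)
Lemma spectral_disc (c : R[i]) (r : R) : exists E : set H,
  [/\ closed_sub E, forall x, E x -> Dn x /\ E (N x),
    forall x, E x -> rp (N x - c *: x) (N x - c *: x) <= r ^+ 2 * rp x x &
    forall y, (forall x, E x -> rp y x = 0) ->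
      r ^+ 2 * rp (Rv y) (Rv y) <= rp (N (Rv y) - c *: Rv y) (N (Rv y) - c *: Rv y)].
Proof.
(* [G] is (r^2 - (N - c)^* (N - c)) R, expanded by means of M N R = 1 - R; hence [b] = r^2 -
   |c|^2. *)
pose b := r ^+ 2 - complex.Re (c * c^*%C).
pose G x := (b%:C *: Rv x + (c^*%C *: N (Rv x) + c *: M (Rv x))) - (x - Rv x).
have Gb : blin G.
  apply: blin_sub; last exact: (blin_sub blin_id Rv_blin).
  apply: blin_add; first exact: (blin_scale b%:C Rv_blin).
  by apply: blin_add; apply: blin_scale; [exact: NRv_blin|exact: MRv_blin].
have GR x : G (Rv x) = Rv (G x).
  rewrite /G !(linB Rv_lin, linD Rv_lin, linZ Rv_lin).
  by rewrite (Rv_N (Rv_dom x)) (Rv_M (Rv_domM x)).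
have GN x : G (N (Rv x)) = N (Rv (G x)).
  have Nl := NRv_blin.1.
  have E1 : N (Rv (N (Rv x))) = (N \o Rv) (N (Rv x)) by [].
  rewrite -[RHS]/((N \o Rv) (G x)) /G.
  rewrite !(linB Nl, linD Nl, linZ Nl) /= Rv_N; last exact: Rv_dom.
  rewrite (Rv_M (Rv_domM x)) NMRvE.
  congr (_ *: _ + (_ + _ *: _) - _).
  by rewrite MNRvE.
pose K := Rv \o G.
have Kb : blin K by exact: blin_comp Rv_blin Gb.
have adjc x y : rp (c^*%C *: N (Rv x)) (Rv y) = rp (Rv x) (c *: M (Rv y)).
  have Dy := Rv_domM y.
  rewrite rpZ_adj conjcK (M_val (Rv_dom x) (domZ M_lin c Dy)).
  by rewrite (opZ M_lin).
have Gform x y : rp (G x) (Rv y) = b * rp (Rv x) (Rv y) +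
    (rp (c^*%C *: N (Rv x)) (Rv y) + rp (c^*%C *: N (Rv y)) (Rv x)) -
    rp (N (Rv x)) (N (Rv y)).
  rewrite /G -MNRvE rpBl !rpDl rpZl (rpC (c *: _)) -adjc (rpC (M _)).
  by rewrite -(M_val (Rv_dom y) (Rv_domN x)) (rpC (N (Rv y))).
have Kq x : rp (K x) x = r ^+ 2 * rp (Rv x) (Rv x) -
    rp (N (Rv x) - c *: Rv x) (N (Rv x) - c *: Rv x).
  rewrite /K /= Rv_herm Gform /b; have := rpZZ c (Rv x).
  have := rpC (N (Rv x)) (c *: Rv x).
  have -> : rp (c^*%C *: N (Rv x)) (Rv x) = rp (N (Rv x)) (c *: Rv x).
    by rewrite rpZ_adj conjcK.
  by rewrite !(rpBl, rpBr); lra.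
have Kh : herm K.
  move=> x y; rewrite /K /= Rv_herm Gform [RHS]rpC (Rv_herm (G y)) Gform.
  rewrite (rpC (Rv x) (Rv y)) (rpC (N (Rv x)) (N (Rv y))).
  by rewrite (addrC (rp (c^*%C *: N (Rv x)) _)).
have [E [Ec EZ Epos Eneg]] := operator_split Kb Kh.
have [E0 EL Eclo] := Ec.
have ER x : E x -> E (Rv x).
  by apply: EZ; [exact: Rv_blin|move=> z /=; rewrite /K /= GR].
have ENR x : E x -> E (N (Rv x)).
  apply: (EZ (N \o Rv)); first exact: NRv_blin.
  by move=> z /=; rewrite /K /= GN (Rv_N (Rv_dom _)).
have Rbound x : E x -> rp (N (Rv x) - c *: Rv x) (N (Rv x) - c *: Rv x) <=
    r ^+ 2 * rp (Rv x) (Rv x).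
  by move=> /Epos; rewrite Kq subr_ge0.
(* The vectors R w with w in E are dense in E, and |N v|^2 <= d |v|^2 for such v, with d = 2 (r^2 +
   |c|^2); so N (R (u n)) is Cauchy and closedness of N puts x in its domain. *)
have Elim x : E x -> exists u, [/\ forall n : nat, E (u n),
    (fun n => Rv (u n)) @ \oo --> x, Dn x, E (N x) &
    (fun n => N (Rv (u n))) @ \oo --> N x].
  move=> Ex.
  have /choice[u hu] n : exists w, E w /\ x - iter n Q x = Rv w.
    by have [w Ew wE] := sub_iterQ n E0 EL ER Ex; exists w.
  have uE n : E (u n) := (hu n).1.
  have ux : (fun n => Rv (u n)) @ \oo --> x.
    under eq_fun do rewrite -(hu _).2.
    exact: approx_cvg.
  pose d := 2 * (r ^+ 2 + complex.Re (c * c^*%C)).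
  have [y uN] : exists y : H, (fun n => N (Rv (u n))) @ \oo --> y.
    apply: (cauchy_of_le ux (c := d)) => n m.
    rewrite -(opB N_lin); try exact: Rv_dom.
    rewrite -(linB Rv_lin); set w := u n - u m.
    have Ew : E w by rewrite /w addrC -scaleN1r; exact: EL.
    have := rpD_sq (N (Rv w) - c *: Rv w) (c *: Rv w).
    have := Rbound _ Ew; rewrite subrK rpZZ /d; lra.
  have [Dx NE] := N_clo (fun n => Rv_dom (u n)) ux uN.
  exists u; split=> //; last by rewrite NE.
  by rewrite NE; apply: Eclo uN => n; exact: ENR.
exists E; split=> //.
- by move=> x /Elim[u []].
- move=> x /Elim[u [uE ux Dx _ uN]]; rewrite -[leLHS]mul1r.
  apply: (cvg_le_rp (u := fun n => N (Rv (u n)) - c *: Rv (u n)) _ ux).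
    apply: cvgB => //; exact: (blin_cvg (blin_scale c blin_id) ux).
  by move=> n; rewrite mul1r; exact: Rbound.
- by move=> y /Eneg; rewrite Kq subr_le0.
Qed.
(** * Normal products BA *)

Section SymmetricFactor.
Context (A B : H -> H).
Hypothesis A_lin : lin_on Dn A.
Hypothesis A_clo : graph_closed Dn A.
Hypothesis A_sym : forall x y, Dn x -> Dn y -> rp (A x) y = rp x (A y).
Hypothesis B_lin : lin B.
Hypothesis B_herm : herm B.
Hypothesis N_BA : forall x, Dn x -> N x = B (A x).

(** <N z, A x> = <A z, B (A x)> = <A z, N x> = <z, A (N x)> for every z in the domain. *)
Lemma A_N x : Dn x -> Dn (N x) -> Dm (A x) /\ M (A x) = A (N x).
Proof.
move=> Dx DNx; apply: M_max => z Dz.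
by rewrite (N_BA Dz) B_herm -(N_BA Dx) A_sym.
Qed.

(** Uniform boundedness: <x, R A z> = <A R x, z> shows that the vectors R A z with |z| <= 1 are
    weakly bounded, hence bounded. *)
Lemma A_Rv_bdd : bdd (A \o Rv).
Proof.
have ARv x z : Dn z -> rp (A (Rv x)) z = rp x (Rv (A z)).
  by move=> Dz; rewrite (A_sym (Rv_dom x) Dz) Rv_herm.
pose F := [set w | exists z, [/\ Dn z, nm z <= 1 & w = Rv (A z)]].
have [|c hc] := @weakly_bounded_bounded F.
  move=> x; exists (nm (A (Rv x))) => _ [z [Dz z1 ->]].
  rewrite -ARv//; apply: le_trans (rp_CS _ _) _.
  by rewrite ler_piMr ?nm_ge0.
have hc' z : Dn z -> nm (Rv (A z)) <= `|c| * nm z.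
  move=> Dz; have [z0|z0] := eqVneq (nm z) 0.
    by rewrite z0 (nm0_eq z0) (op0 A_lin) (lin0 Rv_lin) nm0 mulr0.
  have zp : 0 < nm z by rewrite lt_def z0 nm_ge0.
  have := hc (Rv (A ((nm z)^-1%:C *: z))) _.
  rewrite (opZ A_lin)// (linZ Rv_lin) nmZr gtr0_norm ?invr_gt0// mulrC.
  rewrite ler_pdivrMr// => h; apply: le_trans (h _) _.
    exists ((nm z)^-1%:C *: z); split; first exact: (domZ A_lin).
      by rewrite nmZr gtr0_norm ?invr_gt0// mulVf.
    by rewrite (opZ A_lin)// (linZ Rv_lin).
  by rewrite ler_wpM2r ?nm_ge0// ler_norm.
(* Duality turns the bound on R A into one on A R. Since y may lie outside the domain of A, |y|^2 is
   reached as the limit of <y, u n> = <x, R A (u n)>. *)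
exists `|c| => // x /=; set y := A (Rv x).
have yc := approx_cvg (x := y); pose u n := y - iter n Q y.
have h1 n : rp y (u n) <= nm x * (`|c| * (nm y + nm (u n - y))).
  have Du : Dn (u n) by have [w] := approx_Rv n y; rewrite /u => ->; exact: Rv_dom.
  rewrite /y ARv//; apply: le_trans (rp_le _ _) _.
  rewrite ler_wpM2l ?nm_ge0//; apply: le_trans (hc' _ Du) _.
  rewrite ler_wpM2l// -{1}(subrK y (u n)) addrC; exact: nmD.
have h2 : (fun n => nm x * (`|c| * (nm y + nm (u n - y))) - rp y (u n)) @ \oo
    --> nm x * (`|c| * (nm y + 0)) - rp y y.
  apply: cvgB; last by apply: cvg_rp => //; exact: cvg_cst.
  apply: cvgM; first exact: cvg_cst.
  apply: cvgM; first exact: cvg_cst.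
  by apply: cvgD; [exact: cvg_cst|apply/cvg_nm; exact: yc].
have : 0 <= nm x * (`|c| * (nm y + 0)) - rp y y.
  apply: (@closed_cvg _ _ _ _ _ (fun z : R => 0 <= z)) h2; first exact: closed_ge.
  by near=> n; rewrite subr_ge0.
rewrite addr0 rp_nm subr_ge0 => h3.
have [->|y0] := eqVneq (nm y) 0; first by rewrite mulr_ge0 ?nm_ge0.
have yp : 0 < nm y by rewrite lt_def y0 nm_ge0.
by rewrite -(ler_pM2r yp) -expr2; apply: le_trans h3 _; rewrite mulrA (mulrC (nm x)).
Unshelve. all: by end_near. Qed.

Lemma N_N_norm z : Dn z -> Dn (N z) -> Dm (N z) /\ nm (M (N z)) = nm (N (N z)).
Proof.
move=> Dz DNz; have [Dm' e] := dom_of_dom_adjoint DNz; split=> //.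
by apply: le_anti; rewrite !nm_le ?e.
Qed.

(** Write z = R (z + M N z) and use |M N z| = |N N z|. *)
Lemma A_bdd_N2 : exists2 c : R, 0 <= c & forall z, Dn z -> Dn (N z) ->
  nm (A z) <= c * (nm z + nm (N (N z))).
Proof.
have [c c0 hc] := A_Rv_bdd; exists c => // z Dz DNz.
have [DmNz e] := N_N_norm Dz DNz.
have zE : Rv (z + M (N z)) = z by exact: Rv_eq.
have := hc (z + M (N z)); rewrite /= zE => /le_trans; apply.
by rewrite ler_wpM2l// -e; exact: nmD.
Qed.

Lemma iter_adjoint_N (u : H) : (forall k, Dn (iter k M u)) ->
  forall k, iter k M (N u) = N (iter k M u) /\ Dn (iter k M (N u)).
Proof.
move=> hu.
have h k : N (M (iter k M u)) = M (N (iter k M u)) /\ Dn (N (iter k M u)).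
  have [Dv _] := dom_of_dom_adjoint (hu k).
  have [Dv' DNv] := (NM_dom _).1 (conj Dv (hu k.+1)).
  by rewrite NM_comm//; split=> //; exact: (dom_adjoint DNv).1.
have e k : iter k M (N u) = N (iter k M u).
  by elim: k => [//|k IH]; rewrite !iterS IH (h k).1.
by move=> k; rewrite e; split=> //; exact: (h k).2.
Qed.

(** One factor at a time: N commutes with the powers of M along u, and |N v| = |M v| at v = M^k
    u. *)
Lemma iter_norm k (u : H) : (forall k, Dn (iter k M u)) ->
  Dn (iter k N u) /\ nm (iter k N u) = nm (iter k M u).
Proof.
elim: k u => [|k IH] u hu; first by split=> //; exact: (hu 0%N).
have hN := iter_adjoint_N hu.
have [|D e] := IH (N u); first by move=> j; exact: (hN j).2.
rewrite iterSr; split=> //; rewrite e (hN k).1 iterS.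
have [_ e'] := dom_of_dom_adjoint (hu k).
by apply: le_anti; rewrite !nm_le ?e'.
Qed.

(** For normal N this is the spectral subspace of the disc |z| <= r, described by growth alone. *)
Definition bounded_vector (r : R) x :=
  exists C : R, forall k, Dn (iter k N x) /\ nm (iter k N x) <= C * r ^+ k.

(** * Vectors with geometrically bounded iterates, and the deficiency spaces of A *)

Section BoundedVectors.
Context (r : R) (r_ge0 : 0 <= r).

Lemma bounded_vector_dom x k : bounded_vector r x -> Dn (iter k N x).
Proof. by case=> C /(_ k)[]. Qed.

(** |N^k A x| = |M^k A x| = |A N^k x| <= c (|N^k x| + |N^(k+2) x|), which gives the constant c (C +
    C r^2). *)
Lemma bounded_vector_A x : bounded_vector r x -> bounded_vector r (A x).
Proof.
move=> [C hC].
have D k : Dn (iter k N x) by have [] := hC k.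
have MA k : iter k M (A x) = A (iter k N x).
  elim: k => [//|k IH]; rewrite !iterS IH.
  by have [] := A_N (D k) (D k.+1).
have DA k : Dn (iter k M (A x)).
  by rewrite MA; have [/dom_adjoint[]] := A_N (D k) (D k.+1).
have [c c0 hc] := A_bdd_N2.
exists (c * (C + C * r ^+ 2)) => k.
have [DN ->] := iter_norm k DA; split=> //.
rewrite MA; apply: le_trans (hc _ (D k) (D k.+1)) _.
rewrite -mulrA ler_wpM2l// mulrDl lerD//; first by have [] := hC k.
by have [_ /le_trans] := hC k.+2; apply; rewrite -mulrA -exprD addnC addn2.
Qed.

Lemma bounded_vector_lin a x y : bounded_vector r x -> bounded_vector r y ->
  bounded_vector r (a *: x + y).
Proof.
move=> [C hC] [C' hC'].
have h k : Dn (iter k N (a *: x + y)) /\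
    iter k N (a *: x + y) = a *: iter k N x + iter k N y.
  case: (N_lin) => _ NL NE.
  elim: k => [|k [Dk Nk]].
    by split=> //; apply: NL; [exact: (hC 0%N).1|exact: (hC' 0%N).1].
  rewrite !iterS Nk NE; [|exact: (hC k).1|exact: (hC' k).1].
  by split=> //; apply: NL; [exact: (hC k.+1).1|exact: (hC' k.+1).1].
exists (complex.Re `|a| * C + C') => k; have [Dk Nk] := h k.
split=> //; rewrite Nk; apply: le_trans (nmD _ _) _; rewrite nmZ mulrDl lerD ?(hC' k).2//.
by rewrite -mulrA ler_wpM2l ?(hC k).2// normc_def /= sqrtr_ge0.
Qed.

(** The norms of the iterates are log-convex: |N^(k+1) x|^2 = <N^k x, M N^(k+1) x> <= |N^k x|
    |N^(k+2) x|. *)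
Lemma bounded_vector_N_le x : bounded_vector r x -> nm (N x) <= r * nm x.
Proof.
move=> [C hC].
apply: (@logconvex_growth (fun k => nm (iter k N x)) C) => //= [k|/nm0_eq ->|k|k].
- exact: nm_ge0.
- by rewrite (op0 N_lin) nm0.
- have Dk := (hC k).1; have DNk : Dn (N (iter k N x)) := (hC k.+1).1.
  have [Dm' <-] := N_N_norm Dk DNk.
  by rewrite -rp_nm (M_val Dk Dm') rp_le.
- by have [] := hC k.
Qed.

Lemma bounded_vector_N x : bounded_vector r x -> bounded_vector r (N x).
Proof.
move=> [C hC]; exists (C * r) => k; have := hC k.+1.
by rewrite iterSr exprS mulrA.
Qed.

Lemma A_bdd_bounded_vector : exists2 c : R, 0 <= c &
  forall x, bounded_vector r x -> nm (A x) <= c * nm x.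
Proof.
have [c c0 hc] := A_bdd_N2.
exists (c * (1 + r ^+ 2)) => [|x bx].
  by rewrite mulr_ge0// addr_ge0// sqr_ge0.
have D0 := bounded_vector_dom 0 bx; have D1 := bounded_vector_dom 1 bx.
apply: le_trans (hc _ D0 D1) _; rewrite -mulrA ler_wpM2l// mulrDl mul1r lerD2l.
apply: le_trans (bounded_vector_N_le (bounded_vector_N bx)) _.
by rewrite expr2 -mulrA ler_wpM2l// bounded_vector_N_le.
Qed.

(* Since A is bounded by c on the bounded vectors, c^2 - A^2 is bounded by c^2
   there, while it multiplies <., y> by c^2 + 1. *)
Lemma deficiency_orth (s : R[i]) y x : s * s = -1 ->
  (forall u : H, Dn u -> rp (A u) y = rp u (s *: y)) ->
  bounded_vector r x -> rp x y = 0.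
Proof.
move=> s2 hy bx.
have [c c0 hc] := A_bdd_bounded_vector.
pose T (u : H) := (c ^+ 2)%:C *: u - A (A u).
have T1 (u : H) : bounded_vector r u -> [/\ bounded_vector r (T u),
    rp (T u) y = (c ^+ 2 + 1) * rp u y & rp (T u) (T u) <= (c ^+ 2) ^+ 2 * rp u u].
  move=> bu; have bA := bounded_vector_A bu; have bAA := bounded_vector_A bA.
  have Du := bounded_vector_dom 0 bu; have DA := bounded_vector_dom 0 bA.
  rewrite /= in Du DA.
  split.
  - rewrite /T addrC -scaleN1r; apply: bounded_vector_lin => //.
    rewrite -[_ *: u]addr0; apply: bounded_vector_lin => //.
    by rewrite -(subrr u) addrC -scaleN1r; exact: bounded_vector_lin.
  - rewrite /T rpBl rpZl hy//.
    have -> : rp (A u) (s *: y) = - rp u y.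
      rewrite -[s]conjcK -rpZ_adj -(opZ A_lin)// hy; last exact: (domZ A_lin).
      by rewrite rpZ_adj conjcK scalerA s2 scaleN1r rpNr.
    by rewrite opprK mulrDl mul1r.
  (* |T u|^2 = c^4 |u|^2 - 2 c^2 |A u|^2 + |A A u|^2, where the last term is at most c^2 |A u|^2. *)
  - have e1 : rp (A (A u)) u = rp (A u) (A u) by rewrite A_sym.
    have e2 : rp (A (A u)) (A (A u)) <= c ^+ 2 * rp (A u) (A u).
      rewrite !rp_nm -exprMn ler_sqr ?nnegrE ?mulr_ge0 ?nm_ge0//; exact: hc.
    have c2 := sqr_ge0 c; have := rp_ge0 (A u).
    move: e1 e2 c2; rewrite /T; move: (A (A u)) (rp (A u) (A u)) (c ^+ 2).
    move=> w p d e1 e2 d0 p0; rewrite !rpE (rpC u w) e1.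
    have := mulr_ge0 d0 p0; lra.
have Tk k : [/\ bounded_vector r (iter k T x),
    rp (iter k T x) y = (c ^+ 2 + 1) ^+ k * rp x y &
    nm (iter k T x) <= (c ^+ 2) ^+ k * nm x].
  elim: k => [|k [bk ek lk]]; first by rewrite !expr0 !mul1r.
  rewrite iterS; have [b1 e1 l1] := T1 _ bk; split=> //.
    by rewrite e1 ek (exprS (c ^+ 2 + 1)) mulrA.
  rewrite (exprS (c ^+ 2)) -mulrA; apply: le_trans (ler_wpM2l (sqr_ge0 c) lk).
  by rewrite -ler_sqr ?nnegrE ?mulr_ge0 ?sqr_ge0 ?nm_ge0// exprMn -!rp_nm.
apply/eqP; rewrite -normr_le0.
apply: (@geometric_le0 _ (nm x * nm y) (c ^+ 2) (c ^+ 2 + 1)) => [||k].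
- exact: sqr_ge0.
- by rewrite ltrDl.
- have [_ ek lk] := Tk k.
  have c1 : 0 <= (c ^+ 2 + 1) ^+ k by rewrite exprn_ge0// addr_ge0// sqr_ge0.
  rewrite mulrC -(ger0_norm c1) -normrM -ek; apply: le_trans (rp_CS _ _) _.
  by rewrite (mulrC _ (_ ^+ k)) mulrA ler_wpM2r ?nm_ge0.
Qed.

End BoundedVectors.

(** For y orthogonal to all these vectors, [spectral_disc] at centre 0 gives r^2 p <= q, where p =
    |R y|^2 and q = |N R y|^2. If p > 0, the radius r = q / p + 1 >= 1 contradicts this, as r^2 p >=
    r p = q + p. *)
Lemma bounded_vectors_total y :
  (forall r x, 0 <= r -> bounded_vector r x -> rp x y = 0) -> y = 0.
Proof.
move=> hy; apply: Rv_inj0; apply: rp0_eq; apply/eqP; rewrite eq_le rp_ge0 andbT.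
rewrite leNgt; apply/negP => p0.
set p := rp (Rv y) (Rv y) in p0; pose q := rp (N (Rv y)) (N (Rv y)).
have q0 : 0 <= q / p by rewrite divr_ge0 ?rp_ge0// ltW.
pose r := q / p + 1; have r0 : 0 <= r by rewrite /r; lra.
have [E [[_ _ _] EN Er Eperp]] := spectral_disc 0 r.
have Ebv x : E x -> bounded_vector r x.
  move=> Ex; exists (nm x) => k.
  suff [Ek ek] : E (iter k N x) /\ nm (iter k N x) <= nm x * r ^+ k.
    by split=> //; exact: (EN _ Ek).1.
  elim: k => [|k [Ek ek]]; first by rewrite expr0 mulr1.
  rewrite iterS; split; first exact: (EN _ Ek).2.
  rewrite exprSr mulrA; apply: le_trans (ler_wpM2r r0 ek); rewrite mulrC.
  have := Er _ Ek; rewrite scale0r subr0 !rp_nm -exprMn.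
  by rewrite ler_sqr ?nnegrE ?mulr_ge0 ?nm_ge0.
have := Eperp y _; rewrite scale0r subr0 -/p -/q => h.
have : r ^+ 2 * p <= q.
  by apply: h => x Ex; rewrite rpC; exact: (hy r x r0 (Ebv _ Ex)).
have e : r * p = q + p by rewrite mulrDl mul1r divfK// gt_eqF.
have r1 : 1 <= r by rewrite /r; lra.
have : 0 <= (r - 1) * (r * p) by rewrite mulr_ge0 ?subr_ge0// mulr_ge0// ltW.
rewrite mulrBl mul1r mulrA -expr2 e; lra.
Qed.

Lemma deficiency0 (s : R[i]) y : s * s = -1 ->
  (forall u : H, Dn u -> rp (A u) y = rp u (s *: y)) -> y = 0.
Proof.
move=> s2 hy; apply: bounded_vectors_total => r x r0.
exact: (deficiency_orth r0 s2 hy).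
Qed.

(** The range of A + i contains z + i y, say as the image of x; then y - x lies in the deficiency
    space of - i, so y = x. *)
Lemma A_self_adjoint y z : (forall u : H, Dn u -> rp (A u) y = rp u z) ->
  Dn y /\ A y = z.
Proof.
move=> hy; pose j : R[i] := 'i%C.
have jj : j * j = -1 by rewrite -expr2 sqr_i.
have [w wE] : exists w, w = z + j *: y by exists (z + j *: y).
(* With these targets the Euler equation says that the residual A x + j x - w lies in the deficiency
   space of j. *)
have [x Dx hx] := least_squares (- (j *: w)) w A_lin A_clo.
have t0 : A x + j *: x - w = 0.
  apply: (@deficiency0 j) => // p Dp.
  have h1 := hx p Dp; rewrite opprK !rpE in h1.
  have := A_sym (domZ A_lin j Dx) Dp; rewrite (opZ A_lin)// => h2.
  rewrite [LHS]rpC [RHS]rpC !(scalerBr, scalerDr) scalerA jj scaleN1r.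
  by rewrite !rpE; lra.
have e : A x - z = j *: (y - x).
  apply/eqP; rewrite -subr_eq0 scalerBr opprB addrACA -opprD -wE; exact/eqP.
have yx : y - x = 0.
  apply: (@deficiency0 (- j)); first by rewrite mulrNN.
  move=> u Du; rewrite rpBr hy// A_sym// -rpBr scaleNr -e opprB//.
have xy : x = y by apply/esym/eqP; rewrite -subr_eq0 yx.
by rewrite -xy; split=> //; apply/eqP; rewrite -subr_eq0 e yx scaler0.
Qed.

(** * Positive B: the normal product is symmetric *)

Section PositiveFactor.
Hypothesis B_ge0 : forall x, 0 <= rp (B x) x.

Let form x y := rp (N x) (A y).

Lemma form_sym x y : Dn x -> Dn y -> form x y = form y x.
Proof.
by move=> Dx Dy; rewrite /form !N_BA// B_herm rpC.
Qed.

Lemma form_N x y : Dn x -> Dn (N x) -> Dn y -> Dn (N y) ->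
  form (N x) y = form x (N y).
Proof.
move=> Dx DNx Dy DNy.
by rewrite /form N_BA// B_herm -N_BA// A_sym.
Qed.

(** Degenerate case of Cauchy-Schwarz for B: if <B z, z> = 0, the nonnegative quadratic <B (z + t B
    z), z + t B z> has no constant term, so its linear coefficient 2 |B z|^2 vanishes. *)
Lemma form_eq0 x : Dn x -> form x x = 0 -> N x = 0.
Proof.
move=> Dx; rewrite /form N_BA// => h.
set z := A x in h *; apply: rp0_eq.
apply: (@quad_ge0_coef _ (rp (B (B z)) (B z))) => // t.
have := B_ge0 (z + t%:C *: B z).
rewrite (linD B_lin) (linZ B_lin) !rpE h (B_herm (B z) z).
congr (0 <= _); ring.
Qed.

(* N is symmetric for the positive form <N x, A y> = <B A x, A y>, hence
   bounded below by |Im c| for it after a translation by c; this contradicts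
   the bound r on a disc which does not meet the real axis. *)
Lemma disc_nonreal_eq0 (c : R[i]) (r : R) (E : set H) :
  0 <= r -> r < `|complex.Im c| ->
  (forall a x y, E x -> E y -> E (a *: x + y)) ->
  (forall x, E x -> Dn x /\ E (N x)) ->
  (forall x, E x -> rp (N x - c *: x) (N x - c *: x) <= r ^+ 2 * rp x x) ->
  forall x, E x -> x = 0.
Proof.
move=> r0 rc EL EN Er x Ex.
have ED y (Ey : E y) : Dn y := (EN _ Ey).1.
have EE y (Ey : E y) : E (N y) := (EN _ Ey).2.
have E0 : E 0.
  by rewrite -(subrr x) addrC -scaleN1r; exact: EL.
have EZ a y (Ey : E y) : E (a *: y) by rewrite -[_ *: _]addr0; exact: EL.
pose T y := N y - c *: y.
have ET y : E y -> E (T y).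
  by move=> Ey; rewrite /T addrC -scaleNr; apply: EL => //; exact: EE.
set b := complex.Im c in rc.
have cE y : c *: y = (complex.Re c)%:C *: y + b%:C *: ('i%C *: y).
  by rewrite scalerA -scalerDl {1}(complexE c) (mulrC 'i%C).
(* N - c = (N - a) - i b with c = a + i b. The cross term vanishes, since N - a is symmetric and i
   skew for the form and they commute. *)
have lower y : E y -> b ^+ 2 * form y y <= form (T y) (T y).
  move=> Ey; pose a := complex.Re c; pose p := N y - a%:C *: y.
  have Dy := ED _ Ey; have DNy := ED _ (EE _ Ey).
  have Ep : E p by rewrite /p addrC -scaleNr; apply: EL => //; exact: EE.
  have Dp := ED _ Ep.
  have Eiy := EZ 'i%C _ Ey; have Diy := ED _ Eiy.
  have f1 : form y ('i%C *: y) = 0.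
    have := form_sym Dy Diy; rewrite {2}/form (opZ N_lin)// rp_iC.
    rewrite -(opZ A_lin)// -/(form y ('i%C *: y)); lra.
  have f2 : form (N y) ('i%C *: y) = 0.
    have := form_N Dy DNy Diy (ED _ (EE _ Eiy)).
    rewrite (opZ N_lin)// {2}/form (opZ A_lin)// -[rp (N y) _]opprK -rp_iC.
    rewrite -(opZ N_lin)// -/(form ('i%C *: y) (N y)) (form_sym Diy DNy); lra.
  have f3 : form p ('i%C *: y) = 0.
    rewrite /form /p (opB N_lin) ?(opZ N_lin)//; last exact: (domZ N_lin).
    rewrite rpBl rpZl; move: f1 f2; rewrite /form => -> ->; ring.
  have p0 : 0 <= form p p by rewrite /form N_BA.
  have -> : T y = p - b%:C *: ('i%C *: y) by rewrite /T cE opprD addrA.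
  have Dbiy := ED _ (EZ b%:C _ Eiy).
  have : form (p - b%:C *: ('i%C *: y)) (p - b%:C *: ('i%C *: y)) =
      form p p - b * form p ('i%C *: y) - b * form ('i%C *: y) p +
      b ^+ 2 * form ('i%C *: y) ('i%C *: y).
    rewrite /form (opB N_lin)// (opB A_lin)// (opZ N_lin b%:C Diy).
    rewrite (opZ A_lin b%:C Diy) !rpBl !rpBr !rpZl !rpZr; ring.
  rewrite (form_sym Diy Dp) f3 => ->.
  rewrite {3}/form (opZ N_lin)// (opZ A_lin)// rp_ii -/(form y y); lra.
(* On E, |N y| <= d |y| with d^2 = 2 (r^2 + |c|^2), and A is bounded by means of N^2. *)
have upper : exists K, forall y, E y -> form y y <= K * rp y y.
  pose d := Num.sqrt (2 * (r ^+ 2 + complex.Re (c * c^*%C))).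
  have d0 : 0 <= d by exact: sqrtr_ge0.
  have cc0 : 0 <= complex.Re (c * c^*%C).
    by case: (c) => p q /=; have := sqr_ge0 p; have := sqr_ge0 q; lra.
  have hN y : E y -> nm (N y) <= d * nm y.
    move=> Ey; apply: nm_le_sq; first by rewrite mulr_ge0 ?nm_ge0.
    rewrite exprMn sqr_sqrtr; last by rewrite mulr_ge0// addr_ge0// sqr_ge0.
    have := rpD_sq (T y) (c *: y); rewrite /T subrK rpZZ -rp_nm.
    have := Er _ Ey; lra.
  have [k k0 hk] := A_bdd_N2.
  exists (d * (k * (1 + d ^+ 2))) => y Ey.
  apply: le_trans (rp_le _ _) _.
  rewrite rp_nm expr2 (_ : _ * (nm y * nm y) =
    (d * nm y) * (k * (1 + d ^+ 2) * nm y)); last by ring.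
  apply: ler_pM; rewrite ?nm_ge0 ?hN//.
  apply: le_trans (hk _ (ED _ Ey) (ED _ (EE _ Ey))) _.
  rewrite -mulrA ler_wpM2l// mulrDl mul1r lerD2l.
  apply: le_trans (hN _ (EE _ Ey)) _.
  by rewrite expr2 -mulrA ler_wpM2l// hN.
have [K hK] := upper.
have iterT k : [/\ E (iter k T x),
    (b ^+ 2) ^+ k * form x x <= form (iter k T x) (iter k T x) &
    rp (iter k T x) (iter k T x) <= (r ^+ 2) ^+ k * rp x x].
  elim: k => [|k [Ek lk uk]]; first by rewrite !expr0 !mul1r.
  rewrite iterS; split; first exact: ET.
    rewrite (exprS (b ^+ 2)) -mulrA; apply: le_trans (lower _ Ek).
    by rewrite ler_wpM2l// sqr_ge0.
  rewrite (exprS (r ^+ 2)) -mulrA; apply: le_trans (Er _ Ek) _.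
  by rewrite ler_wpM2l// sqr_ge0.
have rb : r ^+ 2 < b ^+ 2.
  by rewrite -(real_normK (num_real b)) ltr_sqr ?nnegrE.
(* b^(2k) form x x <= form (T^k x) (T^k x) <= |K| r^(2k) |x|^2 for all k, while r < |b|. *)
have f0 : form x x = 0.
  have f_ge0 : 0 <= form x x by rewrite /form N_BA ?B_ge0//; exact: ED.
  apply/eqP; rewrite eq_le f_ge0 andbT.
  apply: (@geometric_le0 _ (`|K| * rp x x) (r ^+ 2) (b ^+ 2)) => // [|k].
    exact: sqr_ge0.
  have [Ek lk uk] := iterT k; rewrite mulrC; apply: le_trans lk _.
  apply: le_trans (hK _ Ek) _.
  apply: le_trans (ler_wpM2r (rp_ge0 _) (ler_norm K)) _.
  by rewrite -mulrA (mulrC (rp x x)) ler_wpM2l.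
(* With N x = 0 the bound on the disc reads |c|^2 |x|^2 <= r^2 |x|^2, although r < |Im c| <= |c|. *)
have Nx := form_eq0 (ED _ Ex) f0.
have := Er _ Ex; rewrite Nx sub0r rpNl rpNr opprK rpZZ => h.
apply: rp0_eq; apply/eqP; rewrite eq_le rp_ge0 andbT leNgt; apply/negP => xp.
move: h; rewrite ler_pM2r//.
have : complex.Re (c * c^*%C) = complex.Re c ^+ 2 + b ^+ 2.
  by rewrite /b; case: (c) => p q /=; ring.
have := sqr_ge0 (complex.Re c); lra.
Qed.

(** For v = R y this number g is Im <N v, v>. The disc of centre i b and radius sqrt (b^2 - 1)
    misses the real axis, so its spectral subspace is 0 and (b^2 - 1) |v|^2 <= |N v - i b v|^2, that
    is 2 b g <= |N v|^2 + |v|^2. *)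
Lemma NRv_symmetric y : rp (N (Rv y)) ('i%C *: Rv y) = 0.
Proof.
set v := Rv y; set g := rp _ _.
apply/eqP; apply: contraT => g0.
have gp : 0 < `|g| by rewrite normr_gt0.
pose X := rp (N v) (N v) + rp v v.
have X0 : 0 <= X by rewrite addr_ge0 ?rp_ge0.
(* Chosen so that |b| >= 1 and 2 b g = 2 |g| + X + 1 > X. *)
pose b := Num.sg g * (1 + (X + 1) / (2 * `|g|)).
have nb : 1 <= `|b|.
  rewrite normrM normr_sg g0 mul1r ger0_norm.
    by rewrite lerDl divr_ge0// ?mulr_ge0//; lra.
  by rewrite addr_ge0// divr_ge0// ?mulr_ge0//; lra.
have bg : 2 * (b * g) = 2 * `|g| + X + 1.
  rewrite /b mulrAC (mulrC (Num.sg g)) -[g * _]mulrC -normrEsg.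
  by field; rewrite gt_eqF.
have b2 : 0 <= b ^+ 2 - 1.
  by rewrite subr_ge0 -(real_normK (num_real b)) -[1](expr1n _ 2) ler_sqr ?nnegrE.
pose r := Num.sqrt (b ^+ 2 - 1).
have r2 : r ^+ 2 = b ^+ 2 - 1 by rewrite sqr_sqrtr.
have rb : r < `|b|.
  rewrite -ltr_sqr ?nnegrE ?sqrtr_ge0// r2 real_normK ?num_real//; lra.
pose c : R[i] := 'i%C * b%:C.
have cE : c = Complex 0 b.
  apply/eqP; rewrite eq_complex /=.
  by apply/andP; split; apply/eqP; ring.
have [E [[_ EL _] EN Er Eperp]] := spectral_disc c r.
have E0 x : E x -> x = 0.
  apply: (@disc_nonreal_eq0 c r E) => //; first exact: sqrtr_ge0.
  by rewrite cE.
have := Eperp y (fun x Ex => etrans (congr1 _ (E0 x Ex)) (rp0r y)).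
have -> : c *: Rv y = b%:C *: ('i%C *: v) by rewrite scalerA mulrC.
rewrite -/v r2 rpBl !rpBr !(rpZl, rpZr) (rpC ('i%C *: v) (N v)) -/g rp_ii.
move: bg X0; rewrite /X; have := gp; lra.
Qed.

Lemma NRv_MRv y : N (Rv y) = M (Rv y).
Proof.
have sym (v w : H) : rp (N (Rv v)) (Rv w) = rp (Rv v) (N (Rv w)).
  (* Polarization: the cross terms at v + i w give the symmetry of N on the range of R. *)
  have := NRv_symmetric (v + 'i%C *: w).
  have Dw := Rv_dom w.
  rewrite (linD Rv_lin) (linZ Rv_lin) (opD N_lin)//; try exact: Rv_dom; last first.
    exact: (domZ N_lin).
  rewrite (opZ N_lin)// scalerDr scale_ii rpDl !rpDr !rpNr rp_ii NRv_symmetric.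
  by rewrite rp_iC NRv_symmetric (rpC (Rv v)); lra.
apply/eqP; rewrite -subr_eq0; apply/eqP; apply: Rv_inj0; apply: orth_eq0 => z.
rewrite Rv_herm rpBl sym (rpC (M _)) -(M_val (Rv_dom z) (Rv_domM y)).
by rewrite rpC subrr.
Qed.

(** N and M agree on the range of R, which contains x - Q^n x; the images of these vectors converge
    to N x and M x. *)
Lemma N_M x : (Dn x <-> Dm x) /\ (Dn x -> N x = M x).
Proof.
split.
  by split=> [/dom_of_dom_adjoint[]|/dom_adjoint[]].
move=> Dx; have [Dx' _] := dom_of_dom_adjoint Dx.
have h1 : (fun n => N (x - iter n Q x)) @ \oo --> N x.
  rewrite (_ : (fun n => _) = fun n => N x - iter n Q (N x)); first exact: approx_cvg.
  apply/funext => n /=; have [Dq <-] := iterQ_N n Dx; exact: (opB N_lin).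
apply: (cvg_unq h1).
rewrite (_ : (fun n => _) = fun n => M x - iter n Q (M x)); first exact: approx_cvg.
apply/funext => n /=; have [Dq <-] := iterQ_M n Dx'; rewrite -(opB M_lin)//.
by have [w ->] := approx_Rv n x; exact: NRv_MRv.
Qed.

End PositiveFactor.
End SymmetricFactor.
End NormalPair.

(** * Adjoints *)

Lemma adjoint_valueP T y : opdom (adjoint ip T) y ->
  adjoint_value ip T y (adjoint ip T y).
Proof. by move=> hy; apply: (xgetPex 0 hy). Qed.

(** A point x of D with |z - x| < |z| would give |z|^2 = <z - x, z> <= |z - x| |z| < |z|^2. *)
Lemma dense_orth (D : set H) z : dense D -> (forall x, D x -> rp x z = 0) ->
  z = 0.
Proof.
move=> dD hz; apply: nm0_eq; apply/eqP; apply: contraT => z0.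
have zp : 0 < nm z by rewrite lt_def z0 nm_ge0.
have [||x [/interior_subset hx Dx]] := dD (ball z (nm z)%:C)^°.
- exists z; apply: nbhsx_ballx; by rewrite ltcR.
- exact: open_interior.
move: hx; rewrite -ball_normE /ball_ /= nmE ltcR => hx.
have := rp_le (z - x) z; rewrite rpBl (hz x Dx) subr0 rp_nm expr2.
by rewrite ler_pM2r// leNgt hx.
Qed.

Lemma adjoint_eq T y z : densely_defined T -> adjoint_value ip T y z ->
  opdom (adjoint ip T) y /\ adjoint ip T y = z.
Proof.
move=> dT hz; have hy : opdom (adjoint ip T) y by exists z.
split=> //; apply/eqP; rewrite -subr_eq0; apply/eqP.
apply: (dense_orth dT) => x Dx.
by rewrite rpBr /rp -(adjoint_valueP hy)// hz// subrr.
Qed.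

(** The hypothesis at 'i x supplies the imaginary parts. *)
Lemma rp_adjoint_value T y z : linear_operator T ->
  (forall x, opdom T x -> rp (T x) y = rp x z) -> adjoint_value ip T y z.
Proof.
move=> Tl h x Dx; apply/eqP; rewrite -subr_eq0; apply/eqP.
have := h _ (domZ Tl 'i%C Dx); rewrite (opZ Tl)// !rp_i => /oppr_inj.
have := h _ Dx; rewrite /rp; case: (ip (T x) y) => p q.
by case: (ip x z) => p' q' /= -> ->; rewrite subrr.
Qed.

Lemma adjoint_lin T : densely_defined T ->
  lin_on (opdom (adjoint ip T)) (adjoint ip T).
Proof.
move=> dT.
have h a y z : opdom (adjoint ip T) y -> opdom (adjoint ip T) z ->
    opdom (adjoint ip T) (a *: y + z) /\
    adjoint ip T (a *: y + z) = a *: adjoint ip T y + adjoint ip T z.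
  move=> /adjoint_valueP hy /adjoint_valueP hz; apply: adjoint_eq => // x Dx.
  by rewrite !ipDr !ipZr hy// hz.
split.
- by exists 0 => x _; rewrite !ip0r.
- by move=> a y z hy hz; have [] := h a y z hy hz.
- by move=> a y z hy hz; have [] := h a y z hy hz.
Qed.

Lemma closed_operator_graph T : closed_operator T -> graph_closed (opdom T) T.
Proof.
move=> cT u x y uD ux uy.
suff [/= Dx ->] : [set p : H * H | opdom T p.1 /\ p.2 = T p.1] (x, y) by [].
apply: (@closed_cvg _ _ \oo _ (fun n => (u n, T (u n))) _ cT).
  by near=> n; split => //=; exact: uD.
exact: cvg_pair.
Unshelve. all: by end_near. Qed.

(** * The product BA as a normal operator with its adjoint *)

Section NormalProduct.
Context (A B : operator H).
Hypothesis A_linear : linear_operator A.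
Hypothesis A_closed : closed_operator A.
Hypothesis A_symmetric : symmetric_operator ip A.
Hypothesis B_bounded : bounded_operator B.
Hypothesis B_self_adjoint : self_adjoint ip B.
Hypothesis BA_normal : normal_operator ip (mul_operator B A).

Let N := mul_operator B A.
Let M := adjoint ip N.

Let opdomN : opdom N = opdom A.
Proof.
case: B_bounded => _ BT _; apply/seteqP; split=> x /=; first by case.
by move=> Dx; rewrite BT.
Qed.

Let B_lin : lin B.
Proof. by case: B_bounded => -[_ _ Bl] BT _ a x y; apply: Bl; rewrite BT. Qed.

Let B_ip x y : ip (B x) y = ip x (B y).
Proof.
case: B_bounded => _ BT _; case: B_self_adjoint => _ [Be Bv].
have Dy : opdom B y by rewrite BT.
rewrite (Bv _ Dy); apply: adjoint_valueP; last by rewrite BT.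
by rewrite -Be.
Qed.

Let N_lin : linear_operator N.
Proof.
case: A_linear => A0 AD AE; split; rewrite ?opdomN// => a x y Dx Dy.
by rewrite /= AE// B_lin.
Qed.

Let N_lin' : lin_on (opdom A) N. Proof. by rewrite -opdomN. Qed.

Let N_dense : densely_defined N. Proof. by case: BA_normal. Qed.

Let A_sym x y : opdom A x -> opdom A y -> rp (A x) y = rp x (A y).
Proof.
case: A_symmetric => _ [As Av] Dx Dy.
by rewrite /rp (adjoint_valueP (As _ Dy))// Av.
Qed.

Let N_clo : graph_closed (opdom A) N.
Proof. by rewrite -opdomN; apply: closed_operator_graph; case: BA_normal. Qed.

Let M_val x y : opdom A x -> opdom M y -> rp (N x) y = rp x (M y).
Proof. by rewrite -opdomN /rp => Dx /adjoint_valueP ->. Qed.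

Let M_max y z : (forall x, opdom A x -> rp (N x) y = rp x z) ->
  opdom M y /\ M y = z.
Proof.
rewrite -opdomN => h; apply: adjoint_eq => //; exact: rp_adjoint_value.
Qed.

Let NM_dom x : (opdom M x /\ opdom A (M x)) <-> (opdom A x /\ opdom M (N x)).
Proof.
case: BA_normal => _ _ [e _]; rewrite -opdomN.
rewrite -[X in X <-> _]/(opdom (mul_operator N M) x) e.
exact: iff_refl.
Qed.

Let NM_comm x : opdom A x -> opdom M (N x) -> N (M x) = M (N x).
Proof.
move=> Dx DNx; case: BA_normal => _ _ [_]; apply.
by have := (NM_dom x).2 (conj Dx DNx); rewrite -{1}opdomN.
Qed.

Let M_lin : lin_on (opdom M) M. Proof. exact: adjoint_lin. Qed.

Let B_herm : herm B. Proof. by move=> x y; rewrite /rp B_ip. Qed.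

Let A_clo : graph_closed (opdom A) A.
Proof. exact: closed_operator_graph. Qed.

Lemma normal_product_self_adjoint : self_adjoint ip A.
Proof.
have [Rv RvP] := resolvent_exists N_lin' N_clo M_max.
have [dA [As Av]] := A_symmetric; split=> //; split; last exact: Av.
apply/seteqP; split=> // y /adjoint_valueP hy.
have [] := A_self_adjoint N_lin' N_clo M_lin M_val M_max NM_dom NM_comm RvP
  A_linear A_clo A_sym B_herm (fun _ _ => erefl) (y := y)
  (z := adjoint ip A y) => // u Du.
by rewrite /rp hy.
Qed.

Lemma positive_product_self_adjoint : positive_operator ip B ->
  self_adjoint ip (mul_operator B A) /\
  eqoperator (mul_operator B A) (mul_operator A B).
Proof.
move=> [_ B_ge0].
have Bge0 x : 0 <= rp (B x) x by have := B_ge0 x; rewrite /rp lecE => /andP[].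
have [Rv RvP] := resolvent_exists N_lin' N_clo M_max.
have NM := N_M N_lin' N_clo M_lin M_val M_max NM_dom NM_comm RvP
  A_linear A_sym B_lin B_herm (fun _ _ => erefl) Bge0.
have NM1 : opdom N = opdom M.
  by rewrite opdomN; apply/seteqP; split=> x; have [[h h'] _] := NM x.
have NM2 x : opdom N x -> N x = M x by rewrite opdomN; have [_] := NM x.
split; first by split.
(* AB is the adjoint of BA: one inclusion is the symmetry of A and B; for the other, <A y, B x> = <B
   A y, x> = <y, M x> puts B x in the domain of the adjoint of A, which is that of A. *)
have ABM x z : (opdom A (B x) /\ A (B x) = z) <-> (opdom M x /\ M x = z).
  have [dA [eA vA]] := normal_product_self_adjoint.
  split=> [[Dx <-]|[Dx <-]].
    apply: M_max => y Dy; rewrite B_herm; exact: A_sym.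
  rewrite eA; have [|h1 h2] := @adjoint_eq A (B x) (M x) dA.
    by move=> y Dy; rewrite -B_ip; apply: (adjoint_valueP Dx); rewrite opdomN.
  by split=> //; rewrite vA ?eA.
have BT : opdom B = setT by case: B_bounded.
split.
  rewrite [LHS]NM1; apply/seteqP; split=> x /=.
    by move=> Dx; rewrite BT; have [] := (ABM x _).2 (conj Dx erefl).
  by move=> [_ Dx]; have [] := (ABM x _).1 (conj Dx erefl).
move=> x Dx; rewrite [LHS]NM2//= ; move: Dx; rewrite [opdom _]NM1 => Dx.
by have [_ ->] := (ABM x _).2 (conj Dx erefl).
Qed.

End NormalProduct.
End InnerProduct.

Unset Implicit Arguments.
Set Strict Implicit.

Theorem theorem2p8 (R : realType) (H : completeNormedModType R[i])
    (ip : {dot H for Num.conj})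
    (ip_norm : forall x : H, `|x| ^+ 2 = ip x x)
    (A B : operator H)
    (A_linear : linear_operator A)
    (A_closed : closed_operator A)
    (A_symmetric : symmetric_operator ip A)
    (B_bounded : bounded_operator B)
    (B_self_adjoint : self_adjoint ip B)
    (BA_normal : normal_operator ip (mul_operator B A)) :
  self_adjoint ip A /\
  (positive_operator ip B ->
     self_adjoint ip (mul_operator B A) /\
     eqoperator (mul_operator B A) (mul_operator A B)).
Proof.
split.
  exact: (normal_product_self_adjoint ip_norm A_linear A_closed A_symmetric
    B_bounded B_self_adjoint BA_normal).
exact: (positive_product_self_adjoint ip_norm A_linear A_closed A_symmetric
  B_bounded B_self_adjoint BA_normal).
Qed.
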